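(* Let $d$ be a positive integer and let $(G_n)_{n\ge 1}$ be a sequence of finite abelian groups with $|G_n|\to\infty$ as $n\to\infty$. Let $C_n$ be a uniformly random element of $\mathrm{Mat}_d(G_n)$. Suppose that $0\notin dR_{\exp(G_n)}$ for all $n\ge1$ and that $\rho_{G_n}\to\delta_m$ weakly, where $m\in\mathbb{N}^*$. Then $$\frac{1}{|G_n|}\log|\det(C_n)|\to c_{m,d}$$ in probability, where $$c_{m,d}=\int_{\mathbb{C}}\log|z|\,d\eta_m^{*d}(z)$$ is a non-negative real number. In other words, for any $\varepsilon,\delta>0$ there exists $n_0\ge1$ such that for all $n\ge n_0$ we have $$\mathbb{P}\Bigl(\exp\bigl((c_{m,d}-\varepsilon)|G_n|\bigr)\le|\det(C_n)|\le\exp\bigl((c_{m,d}+\varepsilon)|G_n|\bigr)\Bigr)\ge1-\delta.$$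
   Context: $\mathbb{N}=\{1,2,3,\dots\}$ and $\mathbb{N}^*=\mathbb{N}\cup\{\infty\}$ is the one-point compactification of $\mathbb{N}$ (discrete topology on $\mathbb{N}$). Measures are Borel measures; $\delta_m$ is the Dirac mass at $m$. For a finite abelian group $G$ (written additively), a $G$-circulant matrix is a complex matrix $(A_{x,y})_{x,y\in G}$ of the form $A_{x,y}=a(x-y)$ for some function $a\colon G\to\mathbb{C}$. $\mathrm{Mat}_d(G)$ is the set of all $G$-circulant matrices with entries in $\{0,1\}$ and exactly $d$ ones in each row and column. This set is non-empty when $|G|\ge d$; $C_n$ is considered for those $n$ with $|G_n|\ge d$ (all sufficiently large $n$). $\exp(G)$ is the exponent of $G$, the least positive integer $r$ such that $rx=0$ for all $x\in G$. For $m\in\mathbb{N}$, $R_m$ is the set of $m$-th roots of unity in $\mathbb{C}$ and $dR_m=\{w_1+\dots+w_d : w_1,\dots,w_d\in R_m\}$ is its $d$-fold sumset. For a finite abelian group $G$, $\rho_G=\frac{1}{|G|}\sum_{x\in G}\delta_{\mathrm{ord}_G(x)}$, regarded as a probability measure on $\mathbb{N}^*$, where $\mathrm{ord}_G(x)$ is the order of $x$ in $G$. For $m\in\mathbb{N}$, $\eta_m=\frac1m\sum_{k=1}^m\delta_{e^{2\pi i k/m}}$ is the uniform distribution on $R_m$, and $\eta_\infty$ is the uniform distribution on the unit circle in $\mathbb{C}$. $\eta_m^{*d}$ is the $d$-fold (additive) convolution of $\eta_m$ with itself on $\mathbb{C}$, i.e. the law of a sum of $d$ independent random variables with law $\eta_m$.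 *)

(* Defs.v *)
From HB Require Import structures.
From mathcomp Require Import all_boot all_order all_algebra all_fingroup all_solvable.
From mathcomp Require Import finmap complex.
From mathcomp Require Import all_classical all_reals all_analysis measurable_realfun.

Set Implicit Arguments.
Unset Strict Implicit.
Unset Printing Implicit Defensive.

Import Order.TTheory GRing.Theory Num.Theory.
Import numFieldNormedType.Exports.
Import ComplexField.

Local Open Scope classical_set_scope.
Local Open Scope ring_scope.

Definition borel (T : ptopologicalType) := g_sigma_algebraType (@open T).

(* The topology of R[i] is the one given by its norm, which the library attaches
   to every numFieldType. *)
HB.instance Definition _ (R : realType) :=
  PseudoPointedMetric.copy R[i] (R[i] : numFieldType)^o.

(* [`|z|] lives in R[i]; this is the modulus with values in R. *)
Definition cabs (R : realType) (z : R[i]) : R := Normc.normc z.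

Definition weak_cvg (T : ptopologicalType) (R : realType)
    (mu_ : nat -> probability (borel T) R) (mu : probability (borel T) R) :=
  forall f : T -> R, continuous f -> bounded_fun f ->
    (\int[mu_ n]_x (f x)%:E @[n --> \oo] --> \int[mu]_x (f x)%:E)%E.

Definition cvg_in_probability (R : realType) (d_ : nat -> measure_display)
    (Omega : forall n, measurableType (d_ n))
    (P : forall n, probability (Omega n) R)
    (X : forall n, Omega n -> \bar R) (c : \bar R) :=
  forall e : R, 0 < e ->
    (P n [set w | e%:E < `|X n w - c|] @[n --> \oo] --> 0)%E.

(* The law of [f i] for [i] uniform in [I]. *)
Section mean_dirac.
Context d (T : measurableType d) (R : realType) (I : finType) (f : I -> T).

Definition mean_dirac (A : set T) : \bar R :=
  (((#|I|%:R)^-1)%:E * \sum_(i : I) \d_(f i) A)%E.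

Let mean_dirac0 : mean_dirac set0 = 0%E.
Proof. by rewrite /mean_dirac big1 ?mule0// => i _; rewrite measure0. Qed.

Let mean_dirac_ge0 A : (0 <= mean_dirac A)%E.
Proof.
by rewrite /mean_dirac mule_ge0 ?lee_fin ?invr_ge0 ?ler0n// sume_ge0.
Qed.

Let mean_diracE : mean_dirac = mscale ((#|I|%:R)^-1)%:nng
  (msum (fun k => \d_(nth point [seq f i | i <- enum I] k)) #|I|).
Proof.
apply/funext => A; rewrite /mean_dirac /mscale /msum/=; congr (_ * _)%E.
rewrite -big_enum/= -[LHS](big_map f xpredT (fun x => \d_x A : \bar R)).
by rewrite (big_nth point) size_map -cardE big_mkord.
Qed.

Let mean_dirac_sigma_additive : semi_sigma_additive mean_dirac.
Proof. by rewrite mean_diracE; exact: measure_semi_sigma_additive. Qed.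

HB.instance Definition _ := isMeasure.Build _ _ _ mean_dirac
  mean_dirac0 mean_dirac_ge0 mean_dirac_sigma_additive.

Lemma mean_dirac_setT : (0 < #|I|)%N -> mean_dirac setT = 1%E.
Proof.
move=> I0; rewrite /mean_dirac.
under eq_bigr do rewrite diracT.
rewrite sumEFin -EFinM sumr_const -[1 *+ _]/(_%:R) mulVf//.
by rewrite pnatr_eq0 -lt0n.
Qed.

End mean_dirac.
Arguments mean_dirac {d T} R {I} f.

Section borel_complex.
Context (R : realType).

Let box (q : rat * rat * rat) : set R[i] :=
  [set z | `|complex.Re z - ratr q.1.1| < ratr q.2 /\
           `|complex.Im z - ratr q.1.2| < ratr q.2].

Let normcD_Re_Im (z : R[i]) : Normc.normc z <= `|complex.Re z| + `|complex.Im z|.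
Proof.
case: z => a b /=; rewrite -[leRHS]ger0_norm ?addr_ge0// -sqrtr_sqr.
rewrite ler_wsqrtr// sqrrD !real_normK ?num_real//.
by rewrite -addrA [X in _ <= _ + X]addrC lerD2l lerDl mulrn_wge0// mulr_ge0.
Qed.

Let open_box (U : set R[i]) : open U ->
  U = \bigcup_(q in [set q | box q `<=` U]) box q.
Proof.
move=> oU; apply/seteqP; split=> [z Uz|z [q /= qU /qU//]].
have : nbhs z U by exact: open_nbhs_nbhs.
case=> /= e e0 zeU.
have [r r0 re] : exists2 r : R, 0 < r & r%:C%C = e.
  case: e e0 {zeU} => a b; rewrite ltcE /= => /andP[/eqP b0 a0].
  by exists a => //=; rewrite b0.
have r40 : 0 < r / 2 / 2 by rewrite !divr_gt0.
have [s] := rat_in_itvoo r40; rewrite in_itv/= => /andP[s0 s1].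
have rat_near (x : R) : exists q : rat, `|x - ratr q| < ratr s.
  have [|q] := @rat_in_itvoo R (x - ratr s) (x + ratr s).
    by rewrite ltrBlDr -addrA ltrDl addr_gt0.
  rewrite in_itv/= => xq.
  by exists q; rewrite distrC ltr_distl.
have [q1 zq1] := rat_near (complex.Re z).
have [q2 zq2] := rat_near (complex.Im z).
exists (q1, q2, s) => //= w [/= wq1 wq2]; apply: zeU => /=.
rewrite -re -[X in X < _]/((Normc.normc (z - w))%:C%C) ltcR.
apply: le_lt_trans (normcD_Re_Im _) _.
have tri (a b c : R) : `|a - c| < ratr s -> `|b - c| < ratr s ->
    `|a - b| < r / 2.
  move=> ac bc; apply: le_lt_trans (ler_distD c a b) _.
  rewrite (distrC c b) (splitr (r / 2)).
  by apply: ltrD; [apply: lt_trans ac s1|apply: lt_trans bc s1].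
rewrite (splitr r) ltrD//.
  rewrite (_ : complex.Re (z - w) = complex.Re z - complex.Re w) ?(tri _ _ (ratr q1))//.
  by case: (z) (w) => [? ?] [].
rewrite (_ : complex.Im (z - w) = complex.Im z - complex.Im w) ?(tri _ _ (ratr q2))//.
by case: (z) (w) => [? ?] [].
Qed.

Lemma measurable_fun_complex d (T : measurableType d) (f : T -> borel R[i]) :
  measurable_fun setT (fun x => complex.Re (f x : R[i])) ->
  measurable_fun setT (fun x => complex.Im (f x : R[i])) ->
  measurable_fun setT f.
Proof.
move=> mRe mIm; apply: (@measurability _ _ T (borel R[i]) setT f (@open R[i])) => //.
move=> _ [U oU <-]; rewrite setTI (open_box oU) preimage_bigcup bigcup_mkcond.
apply: countable_bigcupT_measurable => [|q]; first exact: countableP.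
case: ifPn => // _.
have mlt (g : T -> R) (c e : R) : measurable_fun setT g ->
    measurable [set x | `|g x - c| < e].
  move=> mg; rewrite -[X in measurable X]setTI.
  apply: (measurable_fun_ltr (f := fun x => `|g x - c|) (g := cst e)) => //.
  by apply: measurableT_comp => //; exact: measurable_funB.
rewrite (_ : f @^-1` box q =
  [set x | `|complex.Re (f x : R[i]) - ratr q.1.1| < ratr q.2] `&`
  [set x | `|complex.Im (f x : R[i]) - ratr q.1.2| < ratr q.2])//.
by apply: measurableI; exact: mlt.
Qed.

Let measurable_lip (g : borel R[i] -> R) :
  (forall z w : R[i], `|g z - g w| <= Normc.normc (z - w)) ->
  measurable_fun setT g.
Proof.
move=> gl; apply: (measurability _ (RGenOpens.measurableE R)).
move=> _ [U [a [b ->]] <-]; rewrite setTI; apply: sub_sigma_algebra.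
have oU : open `]a, b[%classic by exact: interval_open.
rewrite openE => z Uz.
have /= := open_nbhs_nbhs (conj oU Uz); case=> /= e e0 eU.
exists (e%:C%C); first by rewrite /= ltcR.
move=> w /=; rewrite -[X in X < _]/((Normc.normc (z - w))%:C%C) ltcR => zw.
by apply: eU; apply: le_lt_trans zw; exact: gl.
Qed.

Lemma measurable_Re :
  measurable_fun setT (fun z : borel R[i] => complex.Re (z : R[i])).
Proof.
apply: measurable_lip => z w; rewrite -lecR.
apply: le_trans (normc_ge_Re (z - w)).
by case: z w => [? ?] [? ?] /=.
Qed.

Lemma measurable_Im :
  measurable_fun setT (fun z : borel R[i] => complex.Im (z : R[i])).
Proof.
apply: measurable_lip => -[a b] [a' b'] /=.
rewrite -sqrtr_sqr ler_wsqrtr// lerDr; exact: sqr_ge0.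
Qed.

Definition caddp (z : borel R[i] * borel R[i]) : borel R[i] :=
  (z.1 : R[i]) + (z.2 : R[i]).

Lemma measurable_caddp : measurable_fun setT caddp.
Proof.
apply: measurable_fun_complex.
  rewrite (_ : (fun _ => _) = fun z => complex.Re (z.1 : R[i]) + complex.Re (z.2 : R[i])).
    by apply: measurable_funD; apply: (measurableT_comp measurable_Re).
  by apply/funext => -[[? ?] [? ?]].
rewrite (_ : (fun _ => _) = fun z => complex.Im (z.1 : R[i]) + complex.Im (z.2 : R[i])).
  by apply: measurable_funD; apply: (measurableT_comp measurable_Im).
by apply/funext => -[[? ?] [? ?]].
Qed.

HB.instance Definition _ := isMeasurableFun.Build _ _ _ _ caddp measurable_caddp.

Definition convolution (mu nu : probability (borel R[i]) R) :
  probability (borel R[i]) R := distribution (mu \x nu)%E caddp.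

Definition conv_pow (mu : probability (borel R[i]) R) (d : nat) :
  probability (borel R[i]) R := iter d (convolution mu) (\d_((0 : R[i]) : borel R[i])).

Definition exp2pi (t : measurableTypeR R) : borel R[i] :=
  Complex (cos (2 * pi * (t : R))) (sin (2 * pi * (t : R))).

Lemma measurable_exp2pi : measurable_fun setT exp2pi.
Proof.
have mlin : measurable_fun setT (fun t : R => 2 * pi * t).
  by apply: (@measurable_funM _ (measurableTypeR R)).
apply: measurable_fun_complex => /=.
  by apply: (measurableT_comp (f := cos)) => //; apply: continuous_measurable_fun;
     exact: continuous_cos.
by apply: (measurableT_comp (f := sin)) => //; apply: continuous_measurable_fun;
   exact: continuous_sin.
Qed.

HB.instance Definition _ := isMeasurableFun.Build _ _ _ _ exp2pi measurable_exp2pi.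

End borel_complex.
Arguments exp2pi {R} t.

Definition posN := discrete_topology {n : nat | (0 < n)%N}.
Definition posN_val (m : posN) : nat := val (m : {n : nat | (0 < n)%N}).
Definition posN_infty := one_point_compactification posN.
HB.instance Definition _ := PointedTopological.on posN_infty.

Section eta.
Context (R : realType).

Definition eta_fin (m : posN) : set (borel R[i]) -> \bar R :=
  mean_dirac R (fun k : 'I_(posN_val m) => exp2pi (k.+1%:R / (posN_val m)%:R)).

HB.instance Definition _ m := Measure.on (eta_fin m).

Let eta_fin_setT m : eta_fin m setT = 1%E.
Proof. by apply: mean_dirac_setT; rewrite card_ord; exact: valP. Qed.

HB.instance Definition _ m :=
  Measure_isProbability.Build _ _ _ (eta_fin m) (eta_fin_setT m).

Definition eta (m : posN_infty) : probability (borel R[i]) R :=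
  if m is Some k then eta_fin k
  else distribution (uniform_prob (@ltr01 R)) exp2pi.

(* [lne] is the extended logarithm, with value -oo at 0. *)
Definition c_const (m : posN_infty) (d : nat) : \bar R :=
  \int[conv_pow (eta m) d]_z lne (cabs (z : R[i]))%:E.

End eta.

Section groups.
Context (R : realType) (G : finZmodType).

Definition ord_G (x : G) : posN_infty :=
  Some (exist (fun n => (0 < n)%N) #[x]%g (order_gt0 x) : posN).

Definition rho : set (borel posN_infty) -> \bar R :=
  mean_dirac R (ord_G : G -> borel posN_infty).

HB.instance Definition _ := Measure.on rho.

Let rho_setT : rho setT = 1%E.
Proof. by apply: mean_dirac_setT; apply/card_gt0P; exists 0. Qed.

HB.instance Definition _ := Measure_isProbability.Build _ _ _ rho rho_setT.

(* Rows and columns are indexed by G through [enum_val : 'I_#|G| -> G]; neither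
   membership in [circulant01] nor the determinant depends on this ordering. *)
Definition circulant (a : G -> R[i]) : 'M[R[i]]_#|G| :=
  \matrix_(i, j) a (enum_val i - enum_val j).

Definition circulant01 (d : nat) : set 'M[R[i]]_#|G| :=
  [set A | [/\ exists a : G -> R[i], A = circulant a,
    forall i j, A i j = 0 \/ A i j = 1,
    forall i, #|[set j | A i j == 1]%SET| = d &
    forall j, #|[set i | A i j == 1]%SET| = d]].

End groups.
Arguments circulant01 R G d : clear implicits.

Section uniform_element.
Context d (Omega : measurableType d) (R : realType) (P : probability Omega R).

Definition uniform_on (T : choiceType) (X : Omega -> T) (S : set T) :=
  [/\ finite_set S, forall w, S (X w) &
    forall s, S s -> measurable (X @^-1` [set s]) /\
      P (X @^-1` [set s]) = (((#|` fset_set S|)%:R)^-1)%:E].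

End uniform_element.

Definition roots_of_unity (R : realType) (m : nat) : set R[i] :=
  [set z | z ^+ m = 1].
Arguments roots_of_unity R m : clear implicits.

Definition sumset (R : realType) (d : nat) (A : set R[i]) : set R[i] :=
  [set z | exists2 w : 'I_d -> R[i], forall i, A (w i) & z = \sum_i w i].

(* Main.v *)
From HB Require Import structures.
Require Import Defs.
From mathcomp Require Import all_boot all_order all_algebra all_fingroup all_solvable.
From mathcomp Require Import finmap complex separable cyclotomic.
From mathcomp Require Import all_classical all_reals all_analysis measurable_realfun.
From mathcomp Require Import ring lra zify.
Set Implicit Arguments.
Unset Strict Implicit.
Unset Printing Implicit Defensive.
Import Order.TTheory GRing.Theory Num.Theory.
Import ComplexField.
Import numFieldNormedType.Exports.
Local Open Scope classical_set_scope.
Local Open Scope ring_scope.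

(** Let [N] be the order of [G]. The circulant matrix of a tuple [s] of [d]
    elements of [G] is diagonalised by the characters of [G], with eigenvalues
    [csum chi s], the sum of the [chi (s j)]. So [1 / N * ln |det|] is the mean
    over characters of [ln |csum chi s|]. If [s] is uniform and [chi] has order
    [k], then [csum chi s] is a sum of [d] independent uniform [k]-th roots of
    unity; and since [G] and its dual have equally many elements killed by each
    exponent, the assumption on orders says that most characters have an order
    that looks like [m]. This makes [c_const] the right candidate; the issue is
    concentration over [s] and the singularity of the logarithm at 0.

    The logarithm is approached from above by polynomials: on the disc of
    radius [d], [ln |z|] is the decreasing limit of the truncations [log_poly]
    of [ln d - 1/2 * sum_j (1 - |z|^2 / d^2)^j / j]. Hence [c_const] is the
    decreasing limit of the means of these polynomials ([c_const_limit]), and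
    these means only involve the moments of [|z|^2].

    Upper bound. For fixed [s], the mean over characters of [|csum chi s|^2r]
    counts the relations [s_f1 + .. + s_fr = s_g1 + .. + s_gr]
    ([moment_over_dual]). The relations that hold identically are counted by
    the moment of the limit law ([moment_over_tuples], [conv_pow_moment]), so
    the random moment is never below its limit ([moment_over_dual_ge]) while
    its mean over [s] is close to it. The means over characters of the
    polynomials therefore converge in L1 ([spectral_mean_deviation]).

    Lower bound. It is enough to bound the mean over [s] of [1 / N * ln |det|]
    from below, that is, to show that for most characters replacing the
    logarithm by [log_poly] costs little on average ([tail_uniform]). For
    finite [m] this is clear: as no sum of [d] roots of unity of order [k]
    vanishes, each of them is at least [d^-(k-1)] in modulus by integrality
    ([sum_unity_lower_bound]). For [m = oo] the relevant orders [k] tend to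
    infinity. Comparison with a Fejer kernel shows that [csum chi s] lies in a
    given ball of radius [r >= 1 / k] with probability [O(r)] ([ball_mean_le]);
    this controls the logarithm down to the scale [1 / k]. Below that scale
    integrality bounds the logarithm by [k ln d], and the event has probability
    [o(1 / k)]: given the other [d - 1] terms, the remaining one must fall into
    a ball of radius [1 / k], and their sum must have modulus close to 1, which
    is unlikely for [d >= 3]. The cases [d <= 2] are explicit.

    Both bounds together give convergence in L1 for uniform tuples
    ([log_det_L1_near]), and [c_const >= 0] because a nonzero integer
    determinant has modulus at least 1. Uniform matrices correspond to uniform
    subsets, that is, to tuples conditioned to be injective, which changes
    probabilities by a bounded factor ([uniform_circulant_probability]). *)

(** * Characters and the diagonalisation of circulant matrices *)

Section roots.
Variable F : closedFieldType.

Lemma Xn_sub_1_split (k : nat) : k%:R != 0 :> F ->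
  exists2 rs : seq F, uniq rs & 'X^k - 1 = \prod_(x <- rs) ('X - x%:P).
Proof.
move=> k0; have [rs] := closed_field_poly_normal ('X^k - 1 : {poly F}).
have k1 : (0 < k)%N by case: k k0 => //; rewrite eqxx.
have /monicP -> : ('X^k - 1 : {poly F}) \is monic by rewrite monicXnsubC.
rewrite scale1r => E; exists rs => //.
by rewrite -separable_prod_XsubC -E separable_Xn_sub_1.
Qed.

(** The minimal polynomial divides [X^k - 1], which has simple roots. *)
Lemma diagonalizable_fin_order n (A : 'M[F]_n) (k : nat) : k%:R != 0 :> F ->
  iter k (mulmx A) 1%:M = 1%:M -> exists2 P : 'M[F]_n, P \in unitmx & similar_diag P A.
Proof.
case: n A => [|n] A k0 Ak.
  by exists 1%:M; rewrite ?unitmx1//; apply/is_diag_mxP => -[].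
apply/diagonalizableP; have [rs urs E] := Xn_sub_1_split k0.
exists rs => //; rewrite -E; apply: mxminpoly_min.
rewrite rmorphB rmorph1 /= rmorphXn /= horner_mx_X; apply/eqP; rewrite subr_eq0.
apply/eqP; rewrite -[RHS]Ak; elim: (k) => //= i <-.
by rewrite exprS.
Qed.
End roots.

Lemma mulrn_card (G : finZmodType) (x : G) : x *+ #|G| = 0.
Proof.
have xG : x \in [set: G]%G by rewrite inE.
by have := expg_cardG xG; rewrite cardsT.
Qed.

Definition is_char (G : finZmodType) (F : nzRingType) (chi : G -> F) :=
  chi 0 = 1 /\ {morph chi : x y / x + y >-> x * y}.

Section diagonalize.
Variables (R : realType) (G : finZmodType).
Local Notation N := #|G|.
Implicit Types (x y : G) (a b : G -> R[i]).

Let T x : 'M[R[i]]_N := circulant (fun y => (y == x)%:R).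

Lemma circulantM a b :
  circulant a *m circulant b = circulant (fun x => \sum_y a (x - y) * b y).
Proof.
apply/matrixP => i j; rewrite !mxE.
rewrite (reindex (@enum_rank G)) /=; last exact: onW_bij (@enum_rank_bij G).
rewrite [RHS](reindex_inj (addIr (- enum_val j))) /=.
apply: eq_bigr => y _; rewrite !mxE enum_rankK.
by congr (a _ * _); rewrite opprB addrA subrK.
Qed.

Lemma shiftM x y : T x *m T y = T (x + y).
Proof.
rewrite circulantM; apply/matrixP => i j; rewrite !mxE.
set z := _ - _; rewrite (bigD1 y) //= big1 ?addr0 ?eqxx ?mulr1; last first.
  by move=> w /negPf ->; rewrite mulr0.
by rewrite subr_eq.
Qed.

Lemma shift0 : T 0 = 1%:M.
Proof.
apply/matrixP => i j; rewrite !mxE subr_eq0 (inj_eq enum_val_inj).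
by case: eqP.
Qed.

Lemma shift_trace x : \tr (T x) = N%:R *+ (x == 0).
Proof.
rewrite /mxtrace (eq_bigr (fun=> (x == 0)%:R)); last first.
  by move=> i _; rewrite mxE subrr eq_sym.
by rewrite sumr_const card_ord; case: eqP; rewrite ?mul0rn.
Qed.

Lemma circulant_sum a : circulant a = \sum_x a x *: T x.
Proof.
apply/matrixP => i j; rewrite summxE mxE; set z := _ - _.
rewrite (bigD1 z) //= big1 ?addr0 ?mxE ?eqxx ?mulr1//.
by move=> x /negPf xz; rewrite !mxE eq_sym xz mulr0.
Qed.

(** The shifts [T x] commute and have finite order, so they are simultaneously
    diagonalisable, and every diagonal entry is multiplicative in [x]. Taking
    traces gives the orthogonality relation over the family [lam], from which
    everything else about the dual follows. *)
Lemma circulant_diagonalization : exists lam : 'I_N -> G -> R[i],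
  [/\ forall i, is_char (lam i),
      forall x, \sum_i lam i x = N%:R *+ (x == 0) &
      forall a, \det (circulant a) = \prod_i \sum_x a x * lam i x].
Proof.
have N0 : N%:R != 0 :> R[i].
  by rewrite pnatr_eq0 -lt0n; apply/card_gt0P; exists 0.
have TN x : iter N (mulmx (T x)) 1%:M = 1%:M.
  have -> : forall k, iter k (mulmx (T x)) 1%:M = T (x *+ k).
    by elim=> [|k IH] /=; rewrite ?shift0// IH shiftM -mulrS.
  by rewrite mulrn_card shift0.
have [P Pu /allP Pd] : exists2 P : 'M[R[i]]_N, P \in unitmx &
    all [pred A | similar_diag P A] [seq T x | x <- enum G].
  apply/codiagonalizableP; split.
    move=> _ _ /mapP[x _ ->] /mapP[y _ ->].
    by rewrite /comm_mx !shiftM addrC.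
  by move=> _ /mapP[x _ ->]; apply: diagonalizable_fin_order (TN x).
have {}Pd x : is_diag_mx (P *m T x *m invmx P).
  by have := Pd (T x); rewrite map_f ?mem_enum// /similar_to /= conjumx// => ->.
pose D x := P *m T x *m invmx P.
have DM x y : D x *m D y = D (x + y).
  by rewrite /D !mulmxA mulmxKV// -(mulmxA P) shiftM.
have D0 : D 0 = 1%:M by rewrite /D shift0 mulmx1 mulmxV.
exists (fun i x => D x i i); split=> [i|x|a].
- split=> [|x y]; first by rewrite D0 mxE eqxx.
  rewrite -DM mxE (bigD1 i) //= big1 ?addr0// => j ji.
  by have /is_diag_mxP -> := Pd x; rewrite ?mul0r// eq_sym.
- rewrite -shift_trace; have <- : \tr (D x) = \tr (T x).
    by rewrite /D mxtrace_mulC mulmxA mulVmx// mul1mx.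
  by [].
- have -> : \det (circulant a) = \det (P *m circulant a *m invmx P).
    by rewrite !det_mulmx mulrAC -det_mulmx mulmxV// det1 mul1r.
  have E : P *m circulant a *m invmx P = \sum_x a x *: D x.
    rewrite circulant_sum mulmx_sumr mulmx_suml; apply: eq_bigr => x _.
    by rewrite -scalemxAr -scalemxAl.
  rewrite E det_trig.
    apply: eq_bigr => i _; rewrite summxE; apply: eq_bigr => x _.
    by rewrite mxE.
  apply/is_trig_mxP => i j ij; rewrite summxE big1// => x _; rewrite mxE.
  by have /is_diag_mxP -> := Pd x; rewrite ?mulr0// neq_ltn ij.
Qed.
End diagonalize.

(** * Moduli and averages over finite sets *)

Section modulus.
Variable R : realType.
Implicit Types z w : R[i].

Lemma cabsE z : `|z| = (cabs z)%:C%C. Proof. by []. Qed.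

Lemma cabs_ge0 z : 0 <= cabs z.
Proof. by rewrite -lecR -cabsE normr_ge0. Qed.

Lemma cabs_eq0 z : (cabs z == 0) = (z == 0).
Proof. by rewrite -(inj_eq (@complexI R)) -cabsE normr_eq0. Qed.

Lemma cabs0 : cabs (0 : R[i]) = 0.
Proof. by apply/eqP; rewrite cabs_eq0. Qed.

Lemma cabs1 : cabs (1 : R[i]) = 1.
Proof. by apply: (@complexI R); rewrite -cabsE normr1. Qed.

Lemma cabsM z w : cabs (z * w) = cabs z * cabs w.
Proof. by apply: (@complexI R); rewrite rmorphM -!cabsE normrM. Qed.

Lemma cabsX z n : cabs (z ^+ n) = cabs z ^+ n.
Proof. by apply: (@complexI R); rewrite rmorphXn -!cabsE normrX. Qed.

Lemma cabsN z : cabs (- z) = cabs z.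
Proof. by apply: (@complexI R); rewrite -!cabsE normrN. Qed.

Lemma cabsD z w : cabs (z + w) <= cabs z + cabs w.
Proof. by rewrite -lecR rmorphD /= -!cabsE ler_normD. Qed.

Lemma cabsB z w : cabs (z - w) <= cabs z + cabs w.
Proof. by rewrite -(cabsN w); exact: cabsD. Qed.

Lemma cabs_natr n : cabs (n%:R : R[i]) = n%:R.
Proof. by apply: (@complexI R); rewrite -cabsE normr_nat rmorph_nat. Qed.

Lemma cabs_prod (I : Type) (r : seq I) (P : pred I) (F : I -> R[i]) :
  cabs (\prod_(i <- r | P i) F i) = \prod_(i <- r | P i) cabs (F i).
Proof. by apply: (big_morph (@cabs R)); [exact: cabsM|exact: cabs1]. Qed.

Lemma cabs_sum (I : Type) (r : seq I) (P : pred I) (F : I -> R[i]) :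
  cabs (\sum_(i <- r | P i) F i) <= \sum_(i <- r | P i) cabs (F i).
Proof.
elim/big_rec2: _ => [|i x y _ H]; first by rewrite cabs0.
by apply: le_trans (cabsD _ _) _; rewrite lerD2l.
Qed.

Lemma cabs_sqr z : (cabs z ^+ 2)%:C%C = z * (z^*)%C.
Proof. by rewrite rmorphXn /= -cabsE sqr_normc. Qed.

Lemma cabs_unity z k : (0 < k)%N -> z ^+ k = 1 -> cabs z = 1.
Proof.
move=> k0 zk; apply/eqP; rewrite -(@pexpr_eq1 _ _ k)// ?cabs_ge0//.
by rewrite -cabsX zk cabs1.
Qed.

Lemma conj_unit z : cabs z = 1 -> (z^*)%C = z^-1.
Proof.
move=> z1; have z0 : z != 0 by rewrite -cabs_eq0 z1 oner_eq0.
by apply: (mulfI z0); rewrite -cabs_sqr z1 expr1n divff.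
Qed.

End modulus.

Section mean.
Variable R : realType.

(** Expectations over uniform tuples, group elements or characters are finite
    real averages, so that exchanging them is exchanging finite sums. *)
Definition mean (T : finType) (f : T -> R) : R := (#|T|%:R)^-1 * \sum_x f x.

Variable T : finType.
Hypothesis T0 : (0 < #|T|)%N.
Implicit Types f g : T -> R.

Let NT0 : #|T|%:R != 0 :> R. Proof. by rewrite pnatr_eq0 -lt0n. Qed.

Lemma mean_cst c : mean (fun _ : T => c) = c.
Proof. by rewrite /mean sumr_const -[c *+ _]mulr_natl mulKf. Qed.

Lemma meanD f g : mean (fun x => f x + g x) = mean f + mean g.
Proof. by rewrite /mean big_split mulrDr. Qed.

Lemma meanN f : mean (fun x => - f x) = - mean f.
Proof. by rewrite /mean sumrN mulrN. Qed.

Lemma meanB f g : mean (fun x => f x - g x) = mean f - mean g.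
Proof. by rewrite meanD meanN. Qed.

Lemma meanZ c f : mean (fun x => c * f x) = c * mean f.
Proof. by rewrite /mean -mulr_sumr mulrCA. Qed.

Lemma ler_mean f g : (forall x, f x <= g x) -> mean f <= mean g.
Proof. by move=> fg; rewrite ler_wpM2l ?invr_ge0 ?ler0n// ler_sum. Qed.

Lemma eq_mean f g : f =1 g -> mean f = mean g.
Proof. by move=> fg; rewrite /mean (eq_bigr g). Qed.

Lemma mean_ge0 f : (forall x, 0 <= f x) -> 0 <= mean f.
Proof. by move=> f0; rewrite mulr_ge0 ?invr_ge0 ?ler0n// sumr_ge0. Qed.

Lemma mean_sum (I : Type) (r : seq I) (P : pred I) (F : I -> T -> R) :
  mean (fun x => \sum_(i <- r | P i) F i x) = \sum_(i <- r | P i) mean (F i).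
Proof. by rewrite /mean exchange_big /= mulr_sumr. Qed.

Lemma mean_pred (P : pred T) :
  mean (fun x => (P x)%:R) = (#|[set x | P x]%SET|%:R) / #|T|%:R.
Proof.
rewrite /mean mulrC; congr (_ / _).
by rewrite -sum1_card natr_sum [RHS]big_mkcond; apply: eq_bigr => x _; rewrite inE; case: (P x).
Qed.

End mean.

Lemma mean_exchange (R : realType) (S T : finType) (F : S -> T -> R) :
  mean (fun x => mean (F x)) = mean (fun y => mean (fun x => F x y)).
Proof.
rewrite /mean -!mulr_sumr exchange_big /= mulrCA; congr (_ * (_ * _)).
Qed.

(** Since [|t| = 2 max(t, 0) - t], an upper bound on average together with a
    lower bound on the mean controls the L1 distance. *)
Lemma mean_abs_deviation (R : realType) (T : finType) (f : T -> R) (c : R) :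
  (0 < #|T|)%N ->
  mean (fun x => `|f x - c|) = 2 * mean (fun x => Num.max (f x - c) 0) - (mean f - c).
Proof.
move=> T0; have -> : mean f - c = mean (fun x => f x - c) by rewrite meanB mean_cst.
rewrite -meanZ -meanB; apply: eq_mean => x.
by have [h|h] := leP (f x - c) 0; [rewrite ler0_norm//|rewrite gtr0_norm//]; lra.
Qed.

(** Used to condition on all but one element of a uniform tuple. *)
Lemma mean_dffun_recl (R : realType) (G : finZmodType) n
    (F : {ffun 'I_n.+1 -> G} -> R) :
  mean F = mean (fun x => mean (fun s : {ffun 'I_n -> G} =>
     F [ffun j => oapp s x (unlift ord0 j)])).
Proof.
pose h (p : G * {ffun 'I_n -> G}) : {ffun 'I_n.+1 -> G} :=
  [ffun j => oapp p.2 p.1 (unlift ord0 j)].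
have hb : bijective h.
  exists (fun s : {ffun 'I_n.+1 -> G} => (s ord0, [ffun j => s (lift ord0 j)])).
    move=> [x s]; rewrite /h /= ffunE unlift_none /=; congr pair.
    by apply/ffunP => j; rewrite !ffunE liftK.
  move=> s; apply/ffunP => j; rewrite /h !ffunE /=.
  by case: unliftP => [k ->|->] /=; rewrite ?ffunE.
rewrite /mean -mulr_sumr mulrA -invfM -natrM; congr (_^-1 * _).
  by rewrite !card_ffun !card_ord expnS.
by rewrite pair_big (reindex h) //=; exact: onW_bij.
Qed.

Section characters.
Variables (R : realType) (G : finZmodType) (chi : G -> R[i]).
Hypothesis chi_char : is_char chi.

Lemma charX x n : chi (x *+ n) = chi x ^+ n.
Proof.
elim: n => [|n IH]; first by rewrite mulr0n expr0 chi_char.1.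
by rewrite mulrS exprS chi_char.2 IH.
Qed.

Lemma char_unity x : chi x ^+ #|G| = 1.
Proof. by rewrite -charX mulrn_card chi_char.1. Qed.

Lemma cabs_char x : cabs (chi x) = 1.
Proof. by apply: cabs_unity (char_unity x); apply/card_gt0P; exists 0. Qed.

Lemma char_neq0 x : chi x != 0.
Proof. by rewrite -cabs_eq0 cabs_char oner_eq0. Qed.

Lemma charN x : chi (- x) = (chi x)^-1.
Proof.
by apply: (mulfI (char_neq0 x)); rewrite -chi_char.2 subrr chi_char.1 divff ?char_neq0.
Qed.

Lemma conj_char x : ((chi x)^*)%C = chi (- x).
Proof. by rewrite charN conj_unit ?cabs_char. Qed.

Lemma is_char_exp e : is_char (fun x => chi x ^+ e).
Proof. by split=> [|x y]; rewrite ?chi_char.1 ?expr1n ?chi_char.2 ?exprMn. Qed.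

(** If [chi x != 1], translating the sum by [x] multiplies it by [chi x]. *)
Lemma char_sum : \sum_x chi x = #|G|%:R *+ [forall x, chi x == 1].
Proof.
have [/forallP h|/forallPn[x x1]] := boolP [forall x, chi x == 1].
  by rewrite (eq_bigr (fun=> 1)) ?sumr_const// => x _; apply/eqP.
rewrite mulr0n; set S := \sum_x _.
have : chi x * S = S.
  rewrite /S mulr_sumr [RHS](reindex_inj (addrI x)) /=.
  by apply: eq_bigr => y _; rewrite chi_char.2.
move/eqP; rewrite -subr_eq0 -{2}(mul1r S) -mulrBl mulf_eq0 subr_eq0 (negPf x1).
by move/eqP.
Qed.
End characters.

(** * Orders of characters and integrality *)

Definition trivial_pow (R : realType) (G : finZmodType) (chi : G -> R[i]) (e : nat) :=
  [forall x, chi x ^+ e == 1].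

(** The eigenvalue at [chi] of the circulant matrix of the tuple [s]. *)
Definition csum (R : realType) (G : finZmodType) (d : nat) (chi : G -> R[i])
  (s : {ffun 'I_d -> G}) : R[i] := \sum_j chi (s j).

(** Entries count multiplicities, so that independent uniform elements, with
    possible repetitions, are allowed; on injective tuples this is the 0-1
    circulant matrix of the image. *)
Definition tuple_circulant (R : realType) (G : finZmodType) (d : nat)
    (s : {ffun 'I_d -> G}) : 'M[R[i]]_#|G| :=
  circulant (fun x => #|[set j | s j == x]%SET|%:R).

Section char_order.
Variables (R : realType) (G : finZmodType) (chi : G -> R[i]).
Hypothesis chi_char : is_char chi.

Lemma char_sumX e : \sum_x chi x ^+ e = #|G|%:R *+ trivial_pow chi e.
Proof. exact: (char_sum (is_char_exp chi_char e)). Qed.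

Lemma trivial_powD e f : trivial_pow chi e -> trivial_pow chi (f + e) = trivial_pow chi f.
Proof.
move=> /forallP he; rewrite /trivial_pow; apply: eq_forallb => x.
by rewrite exprD (eqP (he x)) mulr1.
Qed.

(** Euclidean division by the least positive exponent that kills [chi]. *)
Lemma char_order_exists : exists k : nat, [/\ (0 < k)%N,
  (k %| exponent [set: G]%SET)%N & forall e, trivial_pow chi e = (k %| e)%N].
Proof.
have hexp : trivial_pow chi (exponent [set: G]%SET).
  apply/forallP => x; rewrite -charX//.
  have -> : x *+ exponent [set: G]%SET = 0.
    have xG : x \in [set: G]%G by rewrite inE.
    exact: (expg_exponent xG).
  by rewrite chi_char.1.
have ex : exists k, (0 < k)%N && trivial_pow chi k.
  by exists (exponent [set: G]%SET); rewrite exponent_gt0.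
case: (ex_minnP ex) => k /andP[k0 hk] kmin.
have H e : trivial_pow chi e = (k %| e)%N.
  have hkq q : trivial_pow chi (q * k).
    by apply/forallP => x; rewrite mulnC exprM (eqP (forallP hk x)) expr1n.
  rewrite {1}(divn_eq e k) addnC trivial_powD//.
  rewrite /dvdn; case: eqVneq => [->|r0].
    by apply/forallP => x; rewrite expr0.
  apply/negbTE/negP => hr; have := kmin (e %% k)%N; rewrite lt0n r0 hr => /(_ isT).
  by rewrite leqNgt ltn_mod k0.
by exists k; split => //; rewrite -H.
Qed.

Lemma cabs_csum_le d (s : {ffun 'I_d -> G}) : cabs (csum chi s) <= d%:R.
Proof.
apply: le_trans (cabs_sum _ _ _) _.
by rewrite (eq_bigr (fun=> 1)) ?sumr_const ?card_ord// => j _; rewrite cabs_char.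
Qed.

Lemma tuple_circulant_eigen d (s : {ffun 'I_d -> G}) :
  \sum_x #|[set j | s j == x]%SET|%:R * chi x = csum chi s.
Proof.
rewrite /csum (partition_big s xpredT) //=; apply: eq_bigr => x _.
rewrite (eq_bigr (fun=> chi x)); last by move=> j /eqP ->.
by rewrite sumr_const mulr_natl; congr (_ *+ _); apply: eq_card => j; rewrite inE.
Qed.
End char_order.

Section dual.
Variables (R : realType) (G : finZmodType) (lam : 'I_#|G| -> G -> R[i]).
Hypothesis lam_char : forall i, is_char (lam i).
Hypothesis lam_trace : forall x, \sum_i lam i x = #|G|%:R *+ (x == 0).

Let N0 : #|G|%:R != 0 :> R[i].
Proof. by rewrite pnatr_eq0 -lt0n; apply/card_gt0P; exists 0. Qed.

(** Evaluate the sum over [i] and [x] of [lam i (x *+ e)] in both orders. This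
    transfers statistics of orders from [G] to its dual without an isomorphism. *)
Lemma card_trivial_pow e :
  #|[set i | trivial_pow (lam i) e]%SET| = #|[set x : G | x *+ e == 0]%SET|.
Proof.
apply/eqP; rewrite -(eqr_nat R[i]) -(inj_eq (mulfI N0)).
have E (I : finType) (P : pred I) :
    #|[set i | P i]%SET|%:R = \sum_i ((P i)%:R : R[i]).
  by rewrite -sum1_card natr_sum big_mkcond; apply: eq_bigr => i _; rewrite inE; case: (P i).
rewrite !E !mulr_sumr; apply/eqP.
transitivity (\sum_i \sum_x lam i (x *+ e)).
  apply: eq_bigr => i _; rewrite mulr_natr -char_sumX//.
  by apply: eq_bigr => x _; rewrite charX.
rewrite exchange_big /=; apply: eq_bigr => x _.
by rewrite lam_trace mulr_natr.
Qed.

(** Otherwise [chi] would be orthogonal to every [lam i], whereas by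
    [lam_trace] the inner products add up to the order of [G]. *)
Lemma char_in_dual chi : is_char chi -> exists i, lam i =1 chi.
Proof.
move=> chic; case: (pickP (fun i => [forall x, lam i x * chi (- x) == 1])) => [i hi|h].
  exists i => x; have /eqP := forallP hi x.
  by rewrite charN// => /(canRL (mulfVK (char_neq0 chic x))); rewrite mul1r.
have : \sum_i \sum_x lam i x * chi (- x) = #|G|%:R.
  rewrite exchange_big /= (bigD1 0) //= [X in _ + X]big1 ?addr0.
    by rewrite -mulr_suml lam_trace eqxx oppr0 chic.1 mulr1.
  by move=> x /negPf x0; rewrite -mulr_suml lam_trace x0 mul0r.
rewrite big1 => [/esym/eqP|i _]; first by rewrite (negPf N0).
have chi' : is_char (fun x => lam i x * chi (- x)).
  split=> [|x y]; first by rewrite oppr0 (lam_char i).1 chic.1 mulr1.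
  by rewrite opprD (lam_char i).2 chic.2 mulrACA.
by rewrite (char_sum chi') h.
Qed.
End dual.

(** The determinant is an integer. *)
Lemma cabs_det_tuple_circulant_ge1 (R : realType) (G : finZmodType) d
    (s : {ffun 'I_d -> G}) :
  \det (tuple_circulant R s) != 0 -> 1 <= cabs (\det (tuple_circulant R s)).
Proof.
set A := tuple_circulant R s.
pose B : 'M[int]_#|G| := \matrix_(i, j)
  #|[set k | s k == enum_val i - enum_val j]%SET|%:R.
have -> : A = map_mx intr B.
  by apply/matrixP => i j; rewrite !mxE rmorph_nat.
rewrite det_map_mx intr_eq0 => B0.
rewrite -lecR rmorph1 -cabsE -intr_norm -[X in X <= _]/(1%:~R) ler_int.
by rewrite -gtz0_ge1 normr_gt0.
Qed.

(** The sum is an eigenvalue of an integral circulant matrix over [Z/k], whose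
    other [k - 1] eigenvalues are also sums of [d] roots of unity: all are
    nonzero and at most [d] in modulus, and their product is an integer. *)
Lemma sum_unity_lower_bound (R : realType) d k (w : 'I_d -> R[i]) :
  (0 < k)%N -> ~ sumset d (roots_of_unity R k) 0 -> (forall j, w j ^+ k = 1) ->
  1 <= cabs (\sum_j w j) * d%:R ^+ k.-1.
Proof.
case: k => // k _ h0 wk.
have [z zprim] : exists z : R[i], k.+1.-primitive_root z.
  have [|rs urs E] := @Xn_sub_1_split R[i] k.+1; first by rewrite pnatr_eq0.
  have szrs : size rs = k.+1.
    by apply: succn_inj; rewrite -(size_prod_XsubC rs id) -E size_XnsubC.
  have := @has_prim_root _ k.+1 rs isT _ urs; rewrite szrs leqnn => /(_ _ isT).
  have hu : all k.+1.-unity_root rs.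
    apply/allP => x xrs; rewrite unity_rootE.
    have : root ('X^(k.+1) - 1) x by rewrite E root_prod_XsubC.
    by rewrite rootE !hornerE ?hornerXn subr_eq0.
  by move=> /(_ hu) /hasP[z _ zp]; exists z.
pose chi (x : 'I_k.+1) := z ^+ x.
have chic : is_char chi.
  split=> [|x y]; first by rewrite /chi expr0.
  by rewrite /chi -exprD -(prim_expr_mod zprim (x + y)).
have [e he] : exists e : 'I_d -> 'I_k.+1, forall j, w j = z ^+ e j.
  have he j : exists i : 'I_k.+1, w j == z ^+ i.
    by have [i ->] := prim_rootP zprim (wk j); exists i.
  by exists (fun j => xchoose (he j)) => j; apply/eqP/(xchooseP (he j)).
pose s : {ffun 'I_d -> 'I_k.+1} := [ffun j => e j].
have -> : \sum_j w j = csum chi s.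
  by apply: eq_bigr => j _; rewrite ffunE he.
have [lam [lamc lamt lamd]] := circulant_diagonalization R ('I_k.+1).
have dE : \det (tuple_circulant R s) = \prod_i csum (lam i) s.
  by rewrite lamd; apply: eq_bigr => i _; rewrite tuple_circulant_eigen.
have nz i : csum (lam i) s != 0.
  apply/eqP => E; apply: h0; exists (fun j => lam i (s j)) => // j.
  by have := char_unity (lamc i) (s j); rewrite card_ord.
have := @cabs_det_tuple_circulant_ge1 R _ _ s.
rewrite dE => /(_ (introT (prodf_neq0 _ _) (fun i _ => nz i))).
have [i hi] := char_in_dual lamc lamt chic.
rewrite cabs_prod (bigD1 i) //= => H; apply: le_trans H _.
have -> : csum chi s = csum (lam i) s by apply: eq_bigr => j _; rewrite hi.
rewrite ler_wpM2l ?cabs_ge0//.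
have kE : #|[pred j : 'I_#|'I_k.+1| | j != i]| = k.
  apply: succn_inj; rewrite -[RHS](card_ord k.+1) -[RHS]card_ord [in RHS](cardD1 i) inE.
  by congr _.+1; apply: eq_card => j; rewrite !inE andbT.
rewrite -[X in _ ^+ X]kE -prodr_const; apply: ler_prod => j _.
by rewrite cabs_ge0 cabs_csum_le.
Qed.

(** * Even moments as counts of additive relations *)

HB.instance Definition _ (I : finType) (G : finZmodType) :=
  GRing.Zmodule.on {ffun I -> G}.

(** The exponents that kill an element of order [m]; for [m = oo] only 0 does.
    Finite and infinite [m] are treated together through this predicate. *)
Definition order_dvd (m : posN_infty) (e : nat) : bool :=
  if m is Some k then (posN_val k %| e)%N else e == 0%N.

(** Up to exponent [r] the character behaves like one of order [m]; moments of
    degree [r] cannot see more. *)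
Definition matches_order (R : realType) (G : finZmodType) (m : posN_infty) (r : nat)
    (chi : G -> R[i]) :=
  [forall e : 'I_r.+1, trivial_pow chi e == order_dvd m e].

Definition signed_sum (V : zmodType) d r (s : {ffun 'I_d -> V})
    (p : {ffun 'I_r -> 'I_d} * {ffun 'I_r -> 'I_d}) : V :=
  \sum_t s (p.1 t) - \sum_t s (p.2 t).

Section moments.
Variables (R : realType) (G : finZmodType) (d : nat).
Implicit Types (s : {ffun 'I_d -> G}) (chi : G -> R[i]).

(** Expanding the [r]-th power and its conjugate, every choice of [r] plain and
    [r] conjugated terms contributes one character value. *)
Lemma cabs_csum_moment chi s r : is_char chi ->
  (cabs (csum chi s) ^+ r.*2)%:C%C = \sum_p chi (@signed_sum G d r s p).
Proof.
move=> chic; rewrite -muln2 mulnC exprM rmorphXn /= cabs_sqr exprMn.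
have -> : ((csum chi s)^*)%C = csum (fun x => chi (- x)) s.
  by rewrite /csum rmorph_sum /=; apply: eq_bigr => j _; rewrite conj_char.
have expand (F : 'I_d -> R[i]) :
    (\sum_j F j) ^+ r = \sum_(f : {ffun 'I_r -> 'I_d}) \prod_t F (f t).
  by rewrite -(bigA_distr_bigA (fun=> F)) /= prodr_const card_ord.
rewrite /csum !expand mulr_suml.
rewrite -(pair_bigA _ (fun f g => chi (signed_sum s (f, g)))) /=.
apply: eq_bigr => f _; rewrite mulr_sumr; apply: eq_bigr => g _.
rewrite /signed_sum /= chic.2 -sumrN.
by rewrite !(big_morph chi chic.2 chic.1).
Qed.

(** Orthogonality over characters keeps the relations satisfied by [s]. *)
Lemma moment_over_dual (lam : 'I_#|G| -> G -> R[i]) s r :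
  (forall i, is_char (lam i)) ->
  (forall x, \sum_i lam i x = #|G|%:R *+ (x == 0)) ->
  mean (fun i => cabs (csum (lam i) s) ^+ r.*2) =
    #|[set p | @signed_sum G d r s p == 0]%SET|%:R.
Proof.
move=> lamc lamt; apply: (@complexI R); rewrite /mean rmorphM fmorphV /= !rmorph_nat.
rewrite rmorph_sum /= (eq_bigr _ (fun i _ => cabs_csum_moment s r (lamc i))).
rewrite exchange_big /= (eq_bigr _ (fun p _ => lamt (signed_sum s p))).
rewrite card_ord (eq_bigr (fun p => #|G|%:R * (signed_sum s p == 0)%:R)); last first.
  by move=> p _; rewrite mulr_natr.
rewrite -mulr_sumr mulKf; last by rewrite pnatr_eq0 -lt0n; apply/card_gt0P; exists 0.
rewrite -sum1_card natr_sum [RHS]big_mkcond; apply: eq_bigr => p _.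
by rewrite inE; case: eqP.
Qed.

Lemma is_char_signed_sum chi r p : is_char chi ->
  is_char (fun s => chi (@signed_sum G d r s p)).
Proof.
move=> chic; split=> [|s s'].
  by rewrite /signed_sum !big1 ?subrr ?chic.1// => t _; rewrite ffunE.
rewrite -chic.2; congr chi; rewrite /signed_sum addrACA -opprD -!big_split /=.
by congr (_ - _); apply: eq_bigr => t _; rewrite ffunE.
Qed.

(** Orthogonality over tuples keeps the relations that [chi] satisfies
    identically. *)
Lemma moment_over_tuples chi r : is_char chi ->
  mean (fun s => cabs (csum chi s) ^+ r.*2) =
    #|[set p | [forall s, chi (@signed_sum G d r s p) == 1]]%SET|%:R.
Proof.
move=> chic; apply: (@complexI R); rewrite /mean rmorphM fmorphV /= !rmorph_nat.
rewrite rmorph_sum /= (eq_bigr _ (fun s _ => cabs_csum_moment s r chic)).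
rewrite exchange_big /= (eq_bigr _ (fun p _ => char_sum (is_char_signed_sum p chic))).
rewrite (eq_bigr (fun p => #|{ffun 'I_d -> G}|%:R *
    [forall s, chi (@signed_sum G d r s p) == 1]%:R)); last first.
  by move=> p _; rewrite mulr_natr.
rewrite -mulr_sumr mulKf; last by rewrite pnatr_eq0 -lt0n; apply/card_gt0P; exists 0.
rewrite -sum1_card natr_sum [RHS]big_mkcond; apply: eq_bigr => p _.
by rewrite inE; case: ifP.
Qed.

Lemma signed_sumE r s (p : {ffun 'I_r -> 'I_d} * {ffun 'I_r -> 'I_d}) :
  signed_sum s p = \sum_j s j *+ #|[set t | p.1 t == j]%SET|
                 - \sum_j s j *+ #|[set t | p.2 t == j]%SET|.
Proof.
have E (f : {ffun 'I_r -> 'I_d}) : \sum_t s (f t) = \sum_j s j *+ #|[set t | f t == j]%SET|.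
  rewrite (partition_big f xpredT) //=; apply: eq_bigr => j _.
  rewrite (eq_bigr (fun=> s j)); last by move=> t /eqP ->.
  by rewrite sumr_const; congr (_ *+ _); apply: eq_card => t; rewrite inE.
by rewrite /signed_sum !E.
Qed.

(** If [chi] satisfies a relation identically, the differences of multiplicities
    of the relation kill [chi], hence kill [G], and the relation holds for every
    tuple. Thus the random moment never falls below its limit, and closeness of
    the means is enough for closeness in L1. *)
Lemma moment_over_dual_ge (lam : 'I_#|G| -> G -> R[i]) m r chi s :
  (forall i, is_char (lam i)) ->
  (forall x, \sum_i lam i x = #|G|%:R *+ (x == 0)) ->
  is_char chi -> matches_order m r chi ->
  (forall e, (e <= r)%N -> order_dvd m e -> forall x : G, x *+ e = 0) ->
  mean (fun s => cabs (csum chi s) ^+ r.*2) <=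
    mean (fun i => cabs (csum (lam i) s) ^+ r.*2).
Proof.
move=> lamc lamt chic /forallP good hm.
rewrite moment_over_tuples// moment_over_dual// ler_nat subset_leq_card//.
apply/fintype.subsetP => p; rewrite !inE => /forallP triv; rewrite signed_sumE subr_eq0.
apply/eqP; apply: eq_bigr => j _.
set a := #|_|; set b := #|_|.
have ab (x : G) : chi x ^+ a = chi x ^+ b.
  pose sx : {ffun 'I_d -> G} := [ffun k => if k == j then x else 0].
  have := triv sx; rewrite signed_sumE.
  have E (c : 'I_d -> nat) : \sum_k sx k *+ c k = x *+ c j.
    rewrite (bigD1 j) //= big1 ?addr0 ?ffunE ?eqxx// => k /negPf kj.
    by rewrite ffunE kj mul0rn.
  rewrite !E chic.2 charN// !charX// => /eqP H.
  have n0 : chi x ^+ b != 0 by rewrite expf_neq0// char_neq0.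
  by rewrite -[LHS](mulfVK n0) H mul1r.
have bnd f : (#|[set t : 'I_r | f t]%SET| <= r)%N.
  by rewrite -[X in (_ <= X)%N]card_ord max_card.
have key u v : (u <= v <= r)%N -> (forall x, chi x ^+ u = chi x ^+ v) ->
    s j *+ u = s j *+ v.
  move=> /andP[uv vr] huv; have uvr : (v - u < r.+1)%N by rewrite ltnS (leq_trans (leq_subr _ _)).
  have /eqP := good (Ordinal uvr) => /= E.
  have : order_dvd m (v - u).
    rewrite -E; apply/forallP => x; apply/eqP.
    have n0 : chi x ^+ u != 0 by rewrite expf_neq0// char_neq0.
    by apply: (mulfI n0); rewrite -exprD subnKC// mulr1 huv.
  move=> /(hm _ uvr) /(_ (s j)) h.
  by rewrite -(subnKC uv) mulrnDr h addr0.
have [le|/ltnW le] := leqP a b; first by apply: key; rewrite ?le ?bnd.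
by apply/esym/key => //; rewrite le bnd.
Qed.

End moments.

(** * The Laurent expansion of moments on the unit circle *)

(** On the unit circle [|c + w|^2 = w^-1 * (c + w) * (conj c * w + 1)], so
    dividing this polynomial by [w^r] gives [|c + w|^2r]. *)
Definition circle_poly (R : realType) (c : R[i]) (r : nat) : {poly R[i]} :=
  ((c%:P + 'X) * ((c^*)%C%:P * 'X + 1)) ^+ r.

(** The average of [|c + w|^2r] over any family of unit complex numbers for
    which the average of [w^e] is [p |e|]; it lets the group side and the
    measure side be computed separately and compared. *)
Definition circle_moment (R : realType) (p : pred nat) (c : R[i]) (r : nat) : R :=
  complex.Re (\sum_(n < r.*2.+1 | p `|n - r|%N) (circle_poly c r)`_n).

Section circle.
Variable R : realType.
Implicit Types c w : R[i].

Lemma size_circle_poly c r : (size (circle_poly c r) <= r.*2.+1)%N.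
Proof.
have h : (size ((c%:P + 'X) * ((c^*)%C%:P * 'X + 1))%R <= 3)%N.
  apply: leq_trans (size_polyMleq _ _) _.
  have h1 : (size (c%:P + 'X)%R <= 2)%N by rewrite addrC size_XaddC.
  have h2 : (size ((c^*)%C%:P * 'X + 1)%R <= 2)%N.
    by rewrite -polyC1 size_MXaddC oner_eq0 andbF ltnS size_polyC leq_b1.
  by rewrite -subn1 leq_subLR (leq_add h1 h2).
rewrite /circle_poly; elim: r => [|r IH]; first by rewrite expr0 size_poly1.
rewrite exprS; apply: leq_trans (size_polyMleq _ _) _.
by rewrite -subn1 leq_subLR; apply: leq_trans (leq_add h IH) _; rewrite doubleS.
Qed.

Lemma cabs_circle_moment c w r : cabs w = 1 ->
  (cabs (c + w) ^+ r.*2)%:C%C =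
  \sum_(n < r.*2.+1) (circle_poly c r)`_n * (w ^+ n * w ^- r).
Proof.
move=> w1; have w0 : w != 0 by rewrite -cabs_eq0 w1 oner_eq0.
under eq_bigr do rewrite mulrA.
rewrite -mulr_suml -(horner_coef_wide w (size_circle_poly c r)).
rewrite -muln2 mulnC exprM rmorphXn /= cabs_sqr rmorphD /= (conj_unit w1).
rewrite /circle_poly horner_exp -exprVn -exprMn !hornerE; congr (_ ^+ _).
by rewrite -mulrA; congr (_ * _); rewrite mulrDl mulfK// mul1r.
Qed.

Lemma mean_circle_moment (I : finType) (w : I -> R[i]) (p : pred nat) c r :
  (0 < #|I|)%N -> (forall i, cabs (w i) = 1) ->
  (forall e, (e <= r)%N -> \sum_i w i ^+ e = #|I|%:R *+ p e) ->
  mean (fun i => cabs (c + w i) ^+ r.*2) = circle_moment p c r.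
Proof.
move=> I0 w1 wp; have I0' : #|I|%:R != 0 :> R[i] by rewrite pnatr_eq0 -lt0n.
have w0 i : w i != 0 by rewrite -cabs_eq0 w1 oner_eq0.
pose S := \sum_(n < r.*2.+1 | p `|n - r|%N) (circle_poly c r)`_n.
suff E : (mean (fun i => cabs (c + w i) ^+ r.*2))%:C%C = S.
  by rewrite /circle_moment -/S -E.
rewrite /mean rmorphM fmorphV /= rmorph_nat rmorph_sum /=.
rewrite (eq_bigr _ (fun i _ => cabs_circle_moment c r (w1 i))) exchange_big /=.
apply: (mulfI I0'); rewrite mulVKf// /S [in RHS]big_mkcond mulr_sumr /=.
apply: eq_bigr => n _; rewrite -mulr_sumr.
have -> : \sum_i w i ^+ n * w i ^- r = #|I|%:R *+ p `|n - r|%N; last first.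
  by case: (p _); rewrite ?mulr0// mulrC.
have nr : (n <= r.*2)%N by rewrite -ltnS.
have [rn|nr'] := leqP r n.
  rewrite distnEl// -wp; last by rewrite leq_subLR addnn.
  by apply: eq_bigr => i _; rewrite -{1}(subnK rn) exprD mulfK ?expf_neq0.
rewrite distnEr; last exact: ltnW.
transitivity (((\sum_i w i ^+ (r - n))^*)%C).
  rewrite rmorph_sum /=; apply: eq_bigr => i _.
  rewrite rmorphXn /= conj_unit// -[X in _ / _ ^+ X](subnK (ltnW nr')) exprD invfM.
  by rewrite mulrCA divff ?expf_neq0// mulr1 exprVn.
by rewrite wp ?leq_subr// rmorphMn /= rmorph_nat.
Qed.

Lemma char_circle_moment (G : finZmodType) (chi : G -> R[i]) m r c :
  is_char chi -> matches_order m r chi ->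
  mean (fun x => cabs (c + chi x) ^+ r.*2) = circle_moment (order_dvd m) c r.
Proof.
move=> chic /forallP good; apply: mean_circle_moment => [|x|e er].
- by apply/card_gt0P; exists 0.
- by rewrite cabs_char.
- by rewrite char_sumX//; have /eqP /= -> := good (Ordinal (er : (e < r.+1)%N)).
Qed.

(** [exp2pi] with values in the field rather than in its Borel copy. *)
Definition expi (t : R) : R[i] := exp2pi t.

Lemma expiE t : expi t = Complex (cos (2 * pi * t)) (sin (2 * pi * t)).
Proof. by []. Qed.

Lemma expi0 : expi 0 = 1.
Proof. by rewrite expiE mulr0 cos0 sin0. Qed.

Lemma expiD s t : expi (s + t) = expi s * expi t.
Proof.
rewrite !expiE mulrDr cosD sinD; apply/eqP; rewrite eq_complex /=.
by rewrite eqxx /= addrC.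
Qed.

Lemma expiMn t n : expi (n%:R * t) = expi t ^+ n.
Proof.
elim: n => [|n IH]; first by rewrite mul0r expi0.
by rewrite exprS -IH -expiD; congr expi; rewrite mulrSr mulrDl mul1r addrC.
Qed.

Lemma cabs_expi t : cabs (expi t) = 1.
Proof. by rewrite /cabs /= cos2Dsin2 sqrtr1. Qed.

Lemma expi1 : expi 1 = 1.
Proof.
rewrite expiE mulr1 mulrC mulr_natr cos2pi sin2pi.
by [].
Qed.

Lemma expi_eq1 t : 0 <= t -> t < 1 -> expi t = 1 -> t = 0.
Proof.
move=> t0 t1; rewrite expiE => /eqP; rewrite eq_complex /= => /andP[/eqP c1 _].
apply/eqP/negPn/negP => tn0; have {}t0 : 0 < t by rewrite lt_neqAle eq_sym tn0.
have E : 2 * pi * t = (pi * t) *+ 2 by rewrite mulr2n; ring.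
have sp : 0 < sin (pi * t).
  apply: sin_gt0_pi; apply/andP; split; first by rewrite mulr_gt0 ?pi_gt0.
  by rewrite gtr_pMr ?pi_gt0.
move: c1; rewrite E cos_mulr2n cos2sin2 => H.
have : 0 < sin (pi * t) ^+ 2 by rewrite exprn_gt0.
by move: H; lra.
Qed.

Lemma sum_expi k e : (0 < k)%N ->
  \sum_(i < k) expi (i.+1%:R / k%:R) ^+ e = k%:R *+ (k %| e)%N.
Proof.
move=> k0; have k0' : k%:R != 0 :> R by rewrite pnatr_eq0 -lt0n.
pose x := expi (k%:R^-1) ^+ e.
have E i : expi (i%:R / k%:R) ^+ e = x ^+ i by rewrite expiMn -!exprM mulnC.
have zk : expi k%:R^-1 ^+ k = 1 by rewrite -expiMn divff// expi1.
have xk : x ^+ k = 1 by rewrite -E divff// expi1 expr1n.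
rewrite (eq_bigr (fun i : 'I_k => x * x ^+ i)); last by move=> i _; rewrite E exprS.
rewrite -mulr_sumr; have [dv|ndv] := boolP (k %| e)%N.
  have -> : x = 1 by have /dvdnP[q eq] := dv; rewrite /x eq mulnC exprM zk expr1n.
  rewrite (eq_bigr (fun=> 1)) => [|i _]; last by rewrite expr1n.
  by rewrite sumr_const card_ord mul1r.
have x1 : x != 1.
  apply: contra ndv => /eqP x1; rewrite /dvdn -(eqr_nat R).
  have r1 : (e %% k < k)%N by rewrite ltn_mod.
  have : expi ((e %% k)%:R / k%:R) = 1.
    rewrite -[RHS]x1 expiMn /x [X in _ = _ ^+ X](divn_eq e k) exprD mulnC exprM.
    by rewrite zk expr1n mul1r.
  move/expi_eq1; rewrite divr_ge0 ?ler0n// ltr_pdivrMr ?ltr0n// mul1r ltr_nat r1.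
  by move=> /(_ isT isT) /eqP; rewrite mulf_eq0 invr_eq0 (negPf k0') orbF.
have /eqP := subrX1 x k; rewrite xk subrr eq_sym mulf_eq0 subr_eq0 (negPf x1) /=.
by move=> /eqP ->; rewrite mulr0.
Qed.
End circle.

(** * Integrals against the laws on the complex plane *)

Section integrals.
Variable R : realType.
Local Notation mC := (borel R[i]).

Lemma measurable_cabs : measurable_fun setT (fun z : mC => cabs (z : R[i])).
Proof.
have -> : (fun z : mC => cabs (z : R[i])) =
    (fun x : R => Num.sqrt x) \o
    (fun z : mC => complex.Re (z : R[i]) ^+ 2 + complex.Im (z : R[i]) ^+ 2).
  by apply/funext => -[a b].
apply: measurableT_comp.
  by apply: continuous_measurable_fun; exact: sqrt_continuous.
by apply: measurable_funD; apply: measurable_funX; [exact: measurable_Re|exact: measurable_Im].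
Qed.

Lemma measurable_shift (c : R[i]) :
  measurable_fun setT (fun z : mC => (c + (z : R[i])) : mC).
Proof.
apply: measurable_fun_complex.
  rewrite (_ : (fun _ => _) = fun z : mC => complex.Re c + complex.Re (z : R[i])).
    by apply: measurable_funD => //; exact: measurable_Re.
  by apply/funext => -[? ?]; case: c.
rewrite (_ : (fun _ => _) = fun z : mC => complex.Im c + complex.Im (z : R[i])).
  by apply: measurable_funD => //; exact: measurable_Im.
by apply/funext => -[? ?]; case: c.
Qed.

Lemma measurable_cabs_pow (c : R[i]) n :
  measurable_fun setT (fun z : mC => (cabs (c + (z : R[i])) ^+ n)%:E).
Proof.
apply/measurable_EFinP; apply: measurable_funX.
exact: (measurableT_comp measurable_cabs (measurable_shift c)).
Qed.

Lemma ge0_integral_mean_dirac d (T : measurableType d) (I : finType) (f : I -> T)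
    (g : T -> \bar R) : measurable_fun setT g -> (forall x, (0 <= g x)%E) ->
  (\int[mean_dirac R f]_x g x = ((#|I|%:R)^-1)%:E * \sum_(i : I) g (f i))%E.
Proof.
move=> mg g0.
have E : mean_dirac R f = mscale ((#|I|%:R)^-1)%:nng
    (msum (fun k => \d_(nth point [seq f i | i <- enum I] k)) #|I|).
  apply/funext => A; rewrite /mean_dirac /mscale /msum/=; congr (_ * _)%E.
  rewrite -big_enum/= -[LHS](big_map f xpredT (fun x => \d_x A : \bar R)).
  by rewrite (big_nth point) size_map -cardE big_mkord.
rewrite E ge0_integral_mscale// ge0_integral_measure_sum//.
congr (_ * _)%E.
rewrite -[RHS]big_enum/= -[RHS](big_map f xpredT g) (big_nth point) size_map -cardE big_mkord.
by apply: eq_bigr => k _; rewrite integral_dirac// diracT mul1e.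
Qed.

Lemma ge0_integral_convolution (mu nu : probability mC R) (g : mC -> \bar R) :
  measurable_fun setT g -> (forall x, (0 <= g x)%E) ->
  (\int[convolution mu nu]_z g z = \int[mu]_x \int[nu]_y g (((x : R[i]) + (y : R[i]))%R : mC))%E.
Proof.
move=> mg g0; rewrite /convolution ge0_integral_distribution//.
rewrite fubini_tonelli1//.
  by apply: measurableT_comp => //; exact: measurable_caddp.
by move=> z; exact: g0.
Qed.


Lemma circle_moment_expi (c : R[i]) r t :
  cabs (c + expi t) ^+ r.*2 =
  \sum_(n < r.*2.+1) (complex.Re (circle_poly c r)`_n * cos (2 * pi * (n%:R - r%:R) * t)
                    - complex.Im (circle_poly c r)`_n * sin (2 * pi * (n%:R - r%:R) * t)).
Proof.
have E : (cabs (c + expi t) ^+ r.*2)%:C%C =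
    \sum_(n < r.*2.+1) (circle_poly c r)`_n * expi ((n%:R - r%:R) * t).
  rewrite cabs_circle_moment ?cabs_expi//; apply: eq_bigr => n _; congr (_ * _).
  have w0 : expi t ^+ r != 0 by rewrite expf_neq0// -cabs_eq0 cabs_expi oner_eq0.
  by apply: (mulIf w0); rewrite mulfVK// -!expiMn -expiD -mulrDl subrK.
transitivity (complex.Re ((cabs (c + expi t) ^+ r.*2)%:C%C)) => //.
rewrite E (raddf_sum (@complex.Re R)); apply: eq_bigr => n _.
by rewrite expiE mulrA; case: (_`_n) => a b.
Qed.

(** The frequencies are integral, so only constant terms survive a period. *)
Lemma integral_trig (N : nat) (a b k : 'I_N -> R) :
  (forall n, sin (k n) = 0) -> (forall n, cos (k n) = 1) ->
  (\int[lebesgue_measure]_(t in `[0%R, 1%R])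
    (\sum_n (a n * cos (k n * t) - b n * sin (k n * t)))%:E =
   (\sum_(n | k n == 0) a n)%:E)%E.
Proof.
move=> sk ck.
(* A primitive of the [n]-th term; it is periodic unless [k n = 0]. *)
pose F (n : 'I_N) (t : R) : R := if k n == 0 then a n * t else
  (k n)^-1 * (a n * sin (k n * t) + b n * cos (k n * t)).
have dF n t : is_derive t (1 : R) (F n) (a n * cos (k n * t) - b n * sin (k n * t)).
  rewrite /F; case: eqVneq => [->|kn0].
    apply: is_derive_eq; rewrite !mul0r cos0 sin0 mulr0 subr0 mulr1.
    by rewrite /GRing.scale /= mulr1.
  apply: is_derive_eq; rewrite /GRing.scale /=.
  by field.
have fE : (fun t => \sum_n (a n * cos (k n * t) - b n * sin (k n * t))) =
    \sum_n (fun t => a n * cos (k n * t) - b n * sin (k n * t)).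
  by apply/funext => t; rewrite fct_sumE.
have dP t : is_derive t (1 : R) (\sum_n F n)
    (\sum_n (a n * cos (k n * t) - b n * sin (k n * t))) by exact: is_derive_sum.
have cP : continuous (\sum_n F n).
  by move=> t; apply/differentiable_continuous/derivable1_diffP; case: (dP t).
have cf : continuous (fun t => \sum_n (a n * cos (k n * t) - b n * sin (k n * t))).
  rewrite fE => t; apply/differentiable_continuous/derivable1_diffP.
  by apply: derivable_sum => n; apply: ex_derive.
rewrite (@continuous_FTC2 R _ (\sum_n F n)) //.
- rewrite -EFinB !fct_sumE -sumrB; congr EFin.
  rewrite [RHS]big_mkcond; apply: eq_bigr => n _; rewrite /F; case: eqP => _.
    by rewrite mulr0 mulr1 subr0.
  by rewrite !mulr0 !mulr1 sk ck sin0 cos0 subrr.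
- exact: continuous_subspaceT.
- split=> [t _||]; first by case: (dP t).
  + exact/cvg_at_right_filter/cP.
  + exact/cvg_at_left_filter/cP.
- by move=> t _; rewrite derive1E; case: (dP t) => _ ->.
Qed.

Lemma eta_moment m (c : R[i]) r :
  (\int[eta R m]_z (cabs (c + (z : R[i])) ^+ r.*2)%:E =
   (circle_moment (order_dvd m) c r)%:E)%E.
Proof.
have g0 (z : mC) : (0%R <= (cabs (c + (z : R[i])) ^+ r.*2)%:E)%E.
  by rewrite lee_fin exprn_ge0// cabs_ge0.
case: m => [k|].
- rewrite [LHS](_ : _ = \int[mean_dirac R (fun i : 'I_(posN_val k) =>
      exp2pi (i.+1%:R / (posN_val k)%:R)%R)]_z (cabs (c + (z : R[i])) ^+ r.*2)%:E)%E; last by [].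
  rewrite (ge0_integral_mean_dirac _ _ g0); last exact: measurable_cabs_pow.
  have k0 : (0 < posN_val k)%N by exact: valP.
  rewrite sumEFin -EFinM; congr EFin.
  apply: (@mean_circle_moment R 'I_(posN_val k)
    (fun i => expi (i.+1%:R / (posN_val k)%:R)) (order_dvd (Some k))) => [|i|e _].
  + by rewrite card_ord.
  + exact: cabs_expi.
  + by rewrite sum_expi// card_ord.
- rewrite ge0_integral_distribution//; last exact: measurable_cabs_pow.
  rewrite integral_uniform; first last.
  - by move=> t; exact: g0.
  - exact: (measurableT_comp (measurable_cabs_pow c r.*2) (@measurable_exp2pi R)).
  rewrite subr0 invr1 mul1e.
  under eq_integral => t _ do rewrite /= -[exp2pi t]/(expi t) circle_moment_expi.
  have skN (q : nat) : sin (2 * pi * q%:R) = 0 :> R /\ cos (2 * pi * q%:R) = 1 :> R.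
    have := expiMn (1 : R) q; rewrite expi1 expr1n mulr1 expiE => /eqP.
    by rewrite eq_complex /= => /andP[/eqP -> /eqP ->].
  have sk (n : 'I_r.*2.+1) : sin (2 * pi * (n%:R - r%:R)) = 0 :> R /\
      cos (2 * pi * (n%:R - r%:R)) = 1 :> R.
    have [H1 H2] := skN n; have [H3 H4] := skN r.
    by rewrite mulrBr sinB cosB H1 H2 H3 H4; split; ring.
  rewrite (integral_trig _ _ (fun n => (sk n).1) (fun n => (sk n).2)).
  congr EFin; rewrite /circle_moment (raddf_sum (@complex.Re R)).
  apply: eq_bigl => n; rewrite !mulf_eq0 pnatr_eq0 /= (gt_eqF (pi_gt0 R)) /=.
  by rewrite subr_eq0 eqr_nat distn_eq0.
Qed.

Lemma eta_support m : eta R m [set z | (1 < cabs (z : R[i]))%R] = 0%E.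
Proof.
case: m => [k|].
- rewrite [LHS](_ : _ = mean_dirac R (fun i : 'I_(posN_val k) =>
      exp2pi (i.+1%:R / (posN_val k)%:R)) [set z | (1 < cabs (z : R[i]))%R]); last by [].
  rewrite /mean_dirac big1 ?mule0// => i _.
  rewrite diracE memNset//= => H.
  by move/lt_eqF: H => /eqP; apply; exact/esym/cabs_expi.
- rewrite /eta /distribution /pushforward /=.
  rewrite (_ : _ @^-1` _ = set0) ?measure0//.
  apply/seteqP; split=> // t /=.
  by move=> /lt_eqF/eqP; apply; exact/esym/cabs_expi.
Qed.

(** A sum exceeds [d + 1] in modulus only if its first term exceeds 1 or the
    sum of the others exceeds [d]. *)
Lemma conv_pow_support m d : conv_pow (eta R m) d [set z | (d%:R < cabs (z : R[i]))%R] = 0%E.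
Proof.
have mS n : measurable ([set z : mC | (n%:R < cabs (z : R[i]))%R]).
  rewrite -[X in measurable X]setTI; apply: measurable_fun_ltr => //.
  exact: measurable_cabs.
elim: d => [|d IH] /=.
  by rewrite diracE memNset//= => /lt_eqF/eqP; apply; exact/esym/cabs0.
pose A n := [set z : mC | (n%:R < cabs (z : R[i]))%R].
have sub : @caddp R @^-1` A d.+1 `<=` (A 1%N `*` setT) `|` (setT `*` A d).
  move=> [x y]; rewrite /A /caddp /= => xy.
  have [x1|x1] := ltP 1 (cabs (x : R[i])); [by left|right; split=> //].
  have := lt_le_trans xy (cabsD (x : R[i]) (y : R[i])).
  rewrite /= -natr1 => h; rewrite -(ltrD2r 1); apply: (lt_le_trans h).
  by rewrite addrC lerD2l.
apply: (subset_measure0 _ _ sub).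
- rewrite -[X in measurable X]setTI; apply: measurable_caddp => //; exact: mS.
- by apply: measurableU; apply: measurableX => //; exact: mS.
apply: null_set_setU; [by apply: measurableX => //; exact: mS|by apply: measurableX => //; exact: mS|..].
  apply: etrans (product_measure1E _ _ (mS 1%N) measurableT) _.
  by rewrite [X in (X * _)%E]eta_support mul0e.
apply: etrans (product_measure1E _ _ measurableT (mS d)) _.
by rewrite [X in (_ * X)%E]IH mule0.
Qed.

End integrals.

(** * Moments of the convolution powers *)

Section convolution_moments.
Variables (R : realType) (G : finZmodType) (chi : G -> R[i]) (m : posN_infty) (r : nat).
Hypotheses (chi_char : is_char chi) (chi_m : matches_order m r chi).

(** Induction on [d] with a free centre [c]: given the other summands, both
    sides average the same Laurent polynomial in the last one. *)
Lemma conv_pow_moment d (c : R[i]) :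
  (\int[conv_pow (eta R m) d]_z (cabs (c + (z : R[i])) ^+ r.*2)%:E =
   (mean (fun s : {ffun 'I_d -> G} => cabs (c + csum chi s) ^+ r.*2))%:E)%E.
Proof.
have g0 (c' : R[i]) (z : borel R[i]) : (0%R <= (cabs (c' + (z : R[i])) ^+ r.*2)%:E)%E.
  by rewrite lee_fin exprn_ge0// cabs_ge0.
elim: d c => [|d IH] c.
  rewrite integral_dirac//; last exact: measurable_cabs_pow.
  rewrite diracT mul1e; congr EFin.
  rewrite (eq_mean (g := fun=> cabs (c + 0) ^+ r.*2)).
    by rewrite mean_cst// card_ffun card_ord expn0.
  by move=> s; rewrite /csum big_ord0.
rewrite [LHS]ge0_integral_convolution; last 2 first.
- exact: measurable_cabs_pow.
- by move=> z; exact: g0.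
transitivity (\int[eta R m]_x (mean (fun s : {ffun 'I_d -> G} =>
    cabs ((c + csum chi s) + (x : R[i])) ^+ r.*2))%:E)%E.
  apply: eq_integral => x _.
  under eq_integral => y _ do rewrite addrA.
  by rewrite IH; congr EFin; apply: eq_mean => s; rewrite addrAC.
rewrite /mean; under eq_integral => x _ do rewrite EFinM -sumEFin.
rewrite ge0_integralZl_EFin//; last 2 first.
- by move=> x _; apply: sume_ge0 => s _; exact: g0.
- by apply: emeasurable_sum => s _; exact: measurable_cabs_pow.
rewrite ge0_integral_sum//; last by move=> s; exact: measurable_cabs_pow.
rewrite (eq_bigr _ (fun s _ => eta_moment m (c + csum chi s) r)).
rewrite sumEFin -EFinM; congr EFin; rewrite -/(mean _) -/(mean _) mean_dffun_recl.
rewrite mean_exchange; apply: eq_mean => s.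
rewrite -(char_circle_moment _ chi_char chi_m); apply: eq_mean => x.
rewrite /csum big_ord_recl ffunE unlift_none /= addrAC -addrA; congr (cabs (c + (_ + _)) ^+ _).
by apply: eq_bigr => j _; rewrite ffunE liftK.
Qed.
End convolution_moments.

Section log_series.
Variable R : realType.
Implicit Types (x y : R).

Definition log_partial (J : nat) y : R := \sum_(j < J) y ^+ j.+1 / j.+1%:R.

(** The middle term vanishes at 0 and has derivative [t^J / (1 - t)]. *)
Lemma log_series_bounds J y : 0 <= y < 1 ->
  0 <= - ln (1 - y) - log_partial J y <= y ^+ J.+1 / (1 - y).
Proof.
move=> /andP[y0 y1].
pose q : {poly R} := \sum_(j < J) (j.+1%:R^-1) *: 'X^(j.+1).
pose f (t : R) : R := - ln (1 - t) - q.[t].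
have fE t : f t = - ln (1 - t) - log_partial J t.
  by rewrite /f horner_sum; congr (_ - _); apply: eq_bigr => j _; rewrite !hornerE mulrC.
have f0 : f 0 = 0.
  rewrite fE subr0 ln1 oppr0 sub0r /log_partial big1 ?oppr0// => j _.
  by rewrite expr0n mul0r.
have [->|yn0] := eqVneq y 0.
  by rewrite -fE f0 expr0n mul0r lexx.
have {yn0}y0 : 0 < y by rewrite lt_neqAle eq_sym yn0.
have df (t : R) : t < 1 -> is_derive t (1 : R) f (t ^+ J / (1 - t)).
  move=> t1; have t1' : 0 < 1 - t by rewrite subr_gt0.
  have t1n : 1 - t != 0 by rewrite gt_eqF.
  have d0 : is_derive t (1 : R) (fun t : R => 1 - t) (-1).
    by apply: is_derive_eq; rewrite add0r mul1r.
  have d1 : is_derive t (1 : R) (fun t : R => ln (1 - t)) (- (1 - t)^-1).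
    apply: (is_derive_eq (@is_derive1_comp R (@ln R) (fun t => 1 - t) t _ _
      (is_derive1_ln t1') d0)).
    by rewrite mulrN1.
  have dq : q^`().[t] = \sum_(j < J) t ^+ j.
    rewrite /q linear_sum /= horner_sum; apply: eq_bigr => j _.
    by rewrite derivZ derivXn hornerZ hornerMn hornerXn -[_ ^+ _ *+ _]mulr_natl mulKf ?pnatr_eq0.
  apply: is_derive_eq; rewrite opprK dq.
  have := subrX1 t J => E.
  by apply: (mulIf t1n); rewrite mulrBl mulVf// mulfVK// mulrC -mulNr opprB -E; ring.
have cf : {within `[0, y], continuous f}.
  apply: derivable_within_continuous => t; rewrite in_itv /= => /andP[_ ty].
  by case: (df t (le_lt_trans ty y1)).
have [|c] := MVT y0 _ cf (df := fun t => t ^+ J / (1 - t)).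
  by move=> t; rewrite in_itv /= => /andP[_ ty]; apply: df; exact: lt_trans ty y1.
rewrite in_itv /= => /andP[c0 cy]; rewrite f0 !subr0 -fE => ->.
have c1 : 0 < 1 - c by rewrite subr_gt0 (lt_trans cy).
have y1' : 0 < 1 - y by rewrite subr_gt0.
rewrite mulr_ge0 ?divr_ge0 ?exprn_ge0 ?(ltW c0) ?(ltW c1) ?(ltW y0)//=.
rewrite exprSr [leRHS]mulrAC ler_wpM2r ?(ltW y0)// ler_pM ?exprn_ge0 ?invr_ge0 ?(ltW c0) ?(ltW c1)//.
  by rewrite lerXn2r ?nnegrE ?(ltW c0) ?(ltW y0) ?(ltW cy).
by rewrite lef_pV2 ?posrE// lerB// ltW.
Qed.
End log_series.

(** * Polynomial majorants of the logarithm *)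

Section log_polynomials.
Variable R : realType.

(** Truncation, in the variable [t = |z|^2], of
    [ln |z| = ln d - 1/2 * sum_j (1 - t / d^2)^j / j]: a majorant of [ln |z|] on
    the disc of radius [d], decreasing in [J], whose averages depend only on
    even moments. *)
Definition log_poly (d J : nat) : {poly R} :=
  (ln d%:R)%:P -
  \sum_(j < J) (2^-1 * j.+1%:R^-1) *: (1 - (d%:R ^- 2) *: 'X) ^+ j.+1.

Lemma horner_log_poly d J t :
  (log_poly d J).[t] = ln d%:R - 2^-1 * log_partial J (1 - t / d%:R ^+ 2).
Proof.
rewrite /log_poly !hornerE horner_sum; congr (_ - _); rewrite mulr_sumr.
by apply: eq_bigr => j _; rewrite !hornerE /= mulrAC [_ ^- 2 * t]mulrC.
Qed.

Lemma log_partial_ge0 J (y : R) : 0 <= y -> 0 <= log_partial J y.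
Proof. by move=> y0; apply: sumr_ge0 => j _; rewrite divr_ge0 ?exprn_ge0. Qed.

Lemma log_partial_nondecreasing (y : R) : 0 <= y ->
  {homo (fun J => log_partial J y) : n m / (n <= m)%N >-> n <= m}.
Proof.
move=> y0; apply/nondecreasing_seqP => n.
by rewrite /log_partial big_ord_recr /= lerDl divr_ge0 ?exprn_ge0.
Qed.

Lemma log_poly_le d J t : (0 < d)%N -> 0 <= t <= d%:R ^+ 2 ->
  (log_poly d J).[t] <= ln d%:R.
Proof.
move=> d0 /andP[t0 td]; rewrite horner_log_poly gerBl mulr_ge0 ?invr_ge0//.
by rewrite log_partial_ge0// subr_ge0 ler_pdivrMr ?mul1r// exprn_gt0// ltr0n.
Qed.

Lemma log_poly_bounds d J (x : R) : (0 < d)%N -> 0 < x <= d%:R ->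
  0 <= (log_poly d J).[x ^+ 2] - ln x
    <= 2^-1 * (1 - x ^+ 2 / d%:R ^+ 2) ^+ J.+1 / (x ^+ 2 / d%:R ^+ 2).
Proof.
move=> d0 /andP[x0 xd]; have d0' : 0 < d%:R :> R by rewrite ltr0n.
set u := x ^+ 2 / d%:R ^+ 2; have u0 : 0 < u by rewrite divr_gt0 ?exprn_gt0.
have u1 : u <= 1.
  by rewrite ler_pdivrMr ?exprn_gt0// mul1r lerXn2r ?nnegrE// ltW.
have /(log_series_bounds J) : 0 <= 1 - u < 1 by rewrite subr_ge0 u1 ltrBlDr ltrDl.
rewrite opprB [1 + (u - 1)]addrC subrK horner_log_poly -/u.
have -> : ln u = 2 * (ln x - ln d%:R).
  by rewrite /u -expr_div_n lnXn ?divr_gt0// ln_div ?posrE// mulr_natl.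
rewrite -mulrA; set E := _ ^+ _ / _; set L := log_partial _ _.
by move=> H; apply/andP; split; move/andP: H => []; lra.
Qed.

(** Away from the origin the remainder of [log_poly_bounds] decays
    geometrically. *)
Lemma log_poly_cvg_uniform d (x0 delta : R) : (0 < d)%N -> 0 < x0 <= 1 -> 0 < delta ->
  exists J0 : nat, forall J, (J0 <= J)%N ->
  forall x, x0 <= x <= d%:R -> (log_poly d J).[x ^+ 2] - ln x <= delta.
Proof.
move=> d0 /andP[x00 x01] del0; have d0' : 0 < d%:R :> R by rewrite ltr0n.
pose u := x0 ^+ 2 / d%:R ^+ 2; have u0 : 0 < u by rewrite divr_gt0 ?exprn_gt0.
have le1 (x : R) : 0 < x -> x <= d%:R -> x ^+ 2 / d%:R ^+ 2 <= 1.
  move=> xpos xd; rewrite ler_pdivrMr ?exprn_gt0// mul1r.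
  by rewrite lerXn2r ?nnegrE ?(ltW xpos) ?(ltW d0').
have u1 : u <= 1 by apply: le1 => //; apply: le_trans x01 _; rewrite ler1n.
have [J0 hJ0] : exists J0 : nat, forall J, (J0 <= J)%N ->
    2^-1 * (1 - u) ^+ J.+1 / u <= delta.
  have del' : 0 < delta * 2 * u by apply: mulr_gt0 => //; rewrite mulr_gt0.
  have /(@cvg_expr R) : `|1 - u| < 1 by rewrite ger0_norm ?subr_ge0// ltrBlDr ltrDl.
  move=> /cvgrPdist_lt /(_ _ del') [J0 _ hJ]; exists J0 => J JJ.
  have := hJ J.+1 (leqW JJ); rewrite /= sub0r normrN ger0_norm ?exprn_ge0 ?subr_ge0// => h.
  by rewrite ler_pdivrMr//; lra.
exists J0 => J JJ x /andP[x0x xd]; have xpos := lt_le_trans x00 x0x.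
have /andP[_ h1] := log_poly_bounds J d0 (introT andP (conj xpos xd)).
apply: le_trans h1 _; apply: le_trans (hJ0 _ JJ); set u' := x ^+ 2 / d%:R ^+ 2.
have uu : u <= u'.
  rewrite ler_wpM2r ?invr_ge0 ?exprn_ge0 ?(ltW d0')//.
  by rewrite lerXn2r ?nnegrE ?(ltW x00) ?(ltW xpos).
have u0' := lt_le_trans u0 uu; have u1' : u' <= 1 by exact: le1.
have p0 : 0 <= (1 - u') ^+ J.+1 by apply: exprn_ge0; rewrite subr_ge0.
have pu : (1 - u') ^+ J.+1 <= (1 - u) ^+ J.+1.
  by rewrite lerXn2r ?nnegrE ?subr_ge0// lerB.
apply: ler_pM; [by rewrite mulr_ge0|by rewrite invr_ge0 ltW|by rewrite ler_wpM2l|].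
by rewrite lef_pV2 ?posrE.
Qed.

End log_polynomials.

Arguments log_poly {R} d J.

Section log_integral.
Variables (R : realType) (m : posN_infty) (d : nat).
Hypothesis d0 : (0 < d)%N.
Local Notation mC := (borel R[i]).
Local Notation nu := (conv_pow (eta R m) d).

Definition abs_moment (r : nat) : R :=
  fine (\int[nu]_z (cabs (z : R[i]) ^+ r.*2)%:E)%E.

Hypothesis moment_fin : forall r,
  (\int[nu]_z (cabs (z : R[i]) ^+ r.*2)%:E = (abs_moment r)%:E)%E.

Definition poly_mean (p : {poly R}) : R := \sum_(r < size p) p`_r * abs_moment r.

Lemma poly_mean_integral (p : {poly R}) :
  nu.-integrable setT (fun z : mC => (p.[cabs (z : R[i]) ^+ 2])%:E) /\
  (\int[nu]_z (p.[cabs (z : R[i]) ^+ 2])%:E = (poly_mean p)%:E)%E.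
Proof.
have mpow r : measurable_fun setT (fun z : mC => (cabs (z : R[i]) ^+ r)%:E).
  by apply/measurable_EFinP/measurable_funX; exact: measurable_cabs.
have imon (r : nat) : nu.-integrable setT (fun z : mC => (cabs (z : R[i]) ^+ r.*2)%:E).
  apply/integrableP; split; first exact: mpow.
  under eq_integral => z _ do rewrite gee0_abs ?lee_fin ?exprn_ge0 ?cabs_ge0//.
  by rewrite moment_fin ltry.
have -> : (fun z : mC => (p.[cabs (z : R[i]) ^+ 2])%:E) =
    (fun z => \sum_(r < size p) (p`_r)%:E * (cabs (z : R[i]) ^+ r.*2)%:E)%E.
  apply/funext => z; rewrite horner_coef -sumEFin; apply: eq_bigr => r _.
  by rewrite EFinM -exprM mul2n.
have iterm (r : 'I_(size p)) : nu.-integrable setT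
    (fun z : mC => (p`_r)%:E * (cabs (z : R[i]) ^+ r.*2)%:E)%E.
  exact: integrableZl.
split; first exact: integrable_sum.
rewrite integral_sum//.
rewrite /poly_mean -sumEFin; apply: eq_bigr => r _.
by rewrite integralZl// moment_fin.
Qed.

Lemma measurable_lne_cabs : measurable_fun setT (fun z : mC => lne (cabs (z : R[i]))%:E).
Proof.
have -> : (fun z : mC => lne (cabs (z : R[i]))%:E) =
    (fun z => if cabs (z : R[i]) <= 0 then -oo%E else (ln (cabs (z : R[i])))%:E).
  apply/funext => z; case: ifPn => [h|]; first by rewrite le0_lneNy// lee_fin.
  by rewrite -ltNge => h; rewrite lne_EFin.
apply: measurable_fun_ifT => //.
  by apply: measurable_fun_ler => //; exact: measurable_cabs.
by apply/measurable_EFinP; apply: measurableT_comp => //; exact: measurable_cabs.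
Qed.

(* Clipping at 0 makes the sequence monotone on the whole plane; the law is
   carried by the disc, where clipping changes nothing. *)
Let g J (z : mC) : R :=
  2^-1 * log_partial J (Num.max 0 (1 - cabs (z : R[i]) ^+ 2 / d%:R ^+ 2)).

Let maxg0 (z : mC) : 0 <= Num.max 0 (1 - cabs (z : R[i]) ^+ 2 / d%:R ^+ 2).
Proof. by rewrite le_max lexx. Qed.

Let g_ge0 J z : 0 <= g J z.
Proof. by rewrite mulr_ge0 ?invr_ge0// log_partial_ge0. Qed.

Let g_nd z : {homo g^~ z : n p / (n <= p)%N >-> n <= p}.
Proof. by move=> n p np; rewrite ler_wpM2l ?invr_ge0// log_partial_nondecreasing. Qed.

Let mg J : measurable_fun setT (g J).
Proof.
apply: measurable_funM => //; apply: measurable_sum => j.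
apply: measurable_funM => //; apply: measurable_funX.
apply: measurable_maxr => //; apply: measurable_funB => //.
by apply: measurable_funM => //; apply: measurable_funX; exact: measurable_cabs.
Qed.

Let in_disc (z : mC) := cabs (z : R[i]) <= d%:R.

Let gE J (z : mC) : in_disc z -> g J z = ln d%:R - (log_poly d J).[cabs (z : R[i]) ^+ 2].
Proof.
move=> zd; rewrite horner_log_poly opprB addrC subrK /g; congr (_ * log_partial _ _).
apply/max_idPr; rewrite subr_ge0 ler_pdivrMr ?exprn_gt0 ?ltr0n// mul1r.
by rewrite lerXn2r ?nnegrE ?cabs_ge0.
Qed.

Let ae_disc (f h : mC -> \bar R) : (forall z, in_disc z -> f z = h z) -> ae_eq nu setT f h.
Proof.
move=> fh; exists [set z | (d%:R < cabs (z : R[i]))%R]; split.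
- rewrite -[X in measurable X]setTI; apply: measurable_fun_ltr => //.
  exact: measurable_cabs.
- exact: conv_pow_support.
- move=> z /= zfh; rewrite ltNge; apply/negP => zd; apply: zfh => _; exact: fh.
Qed.

Let int_g J : (\int[nu]_z (g J z)%:E = (ln d%:R - poly_mean (log_poly d J))%:E)%E.
Proof.
have [ip ep] := poly_mean_integral (log_poly d J).
have ic : nu.-integrable setT (EFin \o (fun _ : mC => ln d%:R)).
  by apply: finite_measure_integrable_cst.
transitivity (\int[nu]_z ((ln d%:R)%:E - ((log_poly d J).[cabs (z : R[i]) ^+ 2])%:E))%E.
  apply: ae_eq_integral => //.
  - exact/measurable_EFinP.
  - by apply: emeasurable_funB => //; case/integrableP: ip.
  - by apply: ae_disc => z zd; rewrite gE.
rewrite integralB_EFin// ep integral_cst//.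
by rewrite -[X in (_ * X - _)%E]/(nu setT) probability_setT mule1.
Qed.

Let cvg_g (z : mC) : in_disc z ->
  ((g J z)%:E @[J --> \oo] --> (ln d%:R)%:E - lne (cabs (z : R[i]))%:E)%E.
Proof.
move=> zd; have d0' : 0 < d%:R :> R by rewrite ltr0n.
have [z0|z0] := eqVneq (cabs (z : R[i])) 0; last first.
  have {z0} zpos : 0 < cabs (z : R[i]) by rewrite lt_neqAle eq_sym z0 cabs_ge0.
  rewrite lne_EFin// -EFinB; apply: cvg_EFin; first exact: nearW.
  set x := cabs _ in zpos zd *; set u := x ^+ 2 / d%:R ^+ 2.
  have u0 : 0 < u by rewrite divr_gt0 ?exprn_gt0.
  have u1 : u <= 1.
    by rewrite ler_pdivrMr ?exprn_gt0// mul1r lerXn2r ?nnegrE// ltW.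
  have h1 : (fun J => (ln d%:R - ln x) - 2^-1 * (1 - u) ^+ J.+1 / u) @ \oo --> ln d%:R - ln x.
    rewrite -[X in _ --> X]subr0; apply: cvgB; first exact: cvg_cst.
    rewrite -[X in _ --> X](mul0r u^-1); apply: cvgMl.
    rewrite -[X in _ --> X](mulr0 2^-1); apply: cvgMr.
    rewrite (_ : (fun J => (1 - u) ^+ J.+1) = (fun J => (1 - u) * (1 - u) ^+ J)); last first.
      by apply/funext => J; rewrite exprS.
    rewrite -[X in _ --> X](mulr0 (1 - u)); apply: cvgMr.
    by apply: cvg_expr; rewrite ger0_norm ?subr_ge0// ltrBlDr ltrDl.
  apply: (squeeze_cvgr _ h1 (cvg_cst _)); apply: nearW => J.
  rewrite /= gE//; have /andP := @log_poly_bounds R d J x d0 (introT andP (conj zpos zd)).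
  by rewrite -/u => -[]; rewrite -/x; set E := _ / u; lra.
(* At the origin the partial sums are half those of the harmonic series. *)
have -> : lne (cabs (z : R[i]))%:E = -oo%E by rewrite le0_lneNy// z0.
rewrite addey//.
have -> : (fun J => (g J z)%:E) = (fun J => (2^-1 * log_partial J 1)%:E).
  by apply/funext => J; rewrite /g z0 expr0n mul0r subr0 max_r.
apply/cvgeryP; apply: nondecreasing_dvgn_lt.
  by move=> n p np; rewrite ler_wpM2l ?invr_ge0// log_partial_nondecreasing.
move=> hc; apply: (@dvg_harmonic R).
rewrite (_ : series harmonic = (fun J => 2 * (2^-1 * log_partial J (1 : R)))); last first.
  apply/funext => J; rewrite mulVKf// /series /= big_mkord.
  by apply: eq_bigr => j _; rewrite expr1n mul1r.
exact: is_cvgMr.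
Qed.

(** Monotone convergence; the lower bound on [poly_mean] is what makes the
    integral of the logarithm finite. *)
Lemma c_const_limit : (forall J, 0 <= poly_mean (log_poly d J)) ->
  exists c : R, [/\ c_const R m d = c%:E,
    forall J, c <= poly_mean (log_poly d J) &
    poly_mean (log_poly d J) @[J --> \oo] --> c].
Proof.
move=> P0.
set P := fun J => poly_mean (log_poly d J).
have Pni : {homo P : n p / (n <= p)%N >-> p <= n}.
  move=> n p np; rewrite /P -(lerD2l (- ln d%:R)) -lerN2 !opprD !opprK -lee_fin -!int_g.
  apply: ge0_le_integral => //.
  - by move=> z _; rewrite lee_fin g_ge0.
  - exact/measurable_EFinP.
  - exact/measurable_EFinP.
  - by move=> z _; rewrite lee_fin; exact: g_nd.
have Pcvg : cvgn P.
  by apply: nonincreasing_is_cvgn => //; exists 0 => _ [J _ <-]; exact: P0.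
exists (limn P); split=> //; last by move=> J; exact: nonincreasing_cvgn_ge.
pose h (z : mC) : \bar R := limn (fun J => (g J z)%:E).
have cvgh z : ((g J z)%:E @[J --> \oo] --> h z)%E.
  by apply: ereal_nondecreasing_is_cvgn => a b ab; rewrite lee_fin; exact: g_nd.
have mh : measurable_fun setT h.
  apply: (emeasurable_fun_cvg (fun J z => (g J z)%:E)) => [J|z _]; last exact: cvgh.
  exact/measurable_EFinP.
have h0 z : (0 <= h z)%E.
  by apply: lime_ge; [exact: cvgP (cvgh z)|apply: nearW => J; rewrite lee_fin g_ge0].
have inth : (\int[nu]_z h z = (ln d%:R - limn P)%:E)%E.
  rewrite (@monotone_convergence _ _ _ nu _ measurableT (fun J z => (g J z)%:E)).
  - apply/cvg_lim => //; under eq_fun do rewrite int_g.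
    by apply: cvg_EFin; [exact: nearW|apply: cvgB => //; exact: cvg_cst].
  - by move=> J; exact/measurable_EFinP.
  - by move=> J z _; rewrite lee_fin g_ge0.
  - by move=> z _ a b ab; rewrite lee_fin; exact: g_nd.
have ih : nu.-integrable setT h.
  apply/integrableP; split => //.
  by under eq_integral => z _ do rewrite gee0_abs//; rewrite inth ltry.
have ic : nu.-integrable setT (fun _ : mC => (ln d%:R)%:E).
  by apply: finite_measure_integrable_cst.
rewrite /c_const; transitivity (\int[nu]_z ((ln d%:R)%:E - h z))%E.
  apply: ae_eq_integral => //.
  - exact: measurable_lne_cabs.
  - exact: emeasurable_funB.
  - apply: ae_disc => z zd; rewrite /h (cvg_lim _ (cvg_g zd))//.
    by case: (lne _) => [x||] //; rewrite -!EFinB opprB addrC subrK.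
rewrite integralB// inth integral_cst//.
rewrite -[X in (_ * X - _)%E]/(nu setT) probability_setT mule1 -EFinB.
by congr EFin; rewrite opprB addrC subrK.
Qed.

End log_integral.

(** * Concentration over random tuples *)

Section concentration.
Variables (R : realType) (G : finZmodType) (d : nat) (m : posN_infty).
Variable (lam : 'I_#|G| -> G -> R[i]).
Hypothesis lam_char : forall i, is_char (lam i).
Hypothesis lam_trace : forall x, \sum_i lam i x = #|G|%:R *+ (x == 0).
Local Notation tuples := {ffun 'I_d -> G}.

Lemma card_finZmod_gt0 (V : finZmodType) : (0 < #|V|)%N.
Proof. by apply/card_gt0P; exists 0. Qed.

Lemma matches_order_le r r' (chi : G -> R[i]) : (r <= r')%N ->
  matches_order m r' chi -> matches_order m r chi.
Proof.
move=> rr' /forallP h; apply/forallP => e.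
have er : (e < r'.+1)%N by apply: leq_trans (ltn_ord e) _.
exact: (h (Ordinal er)).
Qed.

Lemma abs_moment_char r (chi : G -> R[i]) : is_char chi -> matches_order m r chi ->
  (\int[conv_pow (eta R m) d]_z (cabs (z : R[i]) ^+ r.*2)%:E =
    (mean (fun s : tuples => cabs (csum chi s) ^+ r.*2))%:E)%E.
Proof.
move=> chic good.
have := conv_pow_moment chic good d 0; under eq_integral do rewrite add0r.
by move=> ->; congr EFin; apply: eq_mean => s; rewrite add0r.
Qed.

Lemma poly_mean_char (p : {poly R}) (chi : G -> R[i]) : is_char chi ->
  matches_order m (size p) chi ->
  mean (fun s : tuples => p.[cabs (csum chi s) ^+ 2]) = poly_mean m d p.
Proof.
move=> chic good; rewrite /poly_mean.
under (@eq_mean R) => s.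
  rewrite horner_coef; over.
rewrite mean_sum; apply: eq_bigr => r _; rewrite meanZ; congr (_ * _).
have good' : matches_order m r chi by apply: matches_order_le good; apply: ltnW.
rewrite /abs_moment (abs_moment_char chic good') /=; apply: eq_mean => s.
by rewrite -exprM mul2n.
Qed.

Definition mismatch r : R := mean (fun i => (~~ matches_order m r (lam i))%:R).

Lemma mismatch_ge0 r : 0 <= mismatch r.
Proof. by apply: mean_ge0. Qed.

Let I0 : (0 < #|'I_#|G| |)%N. Proof. by rewrite card_ord card_finZmod_gt0. Qed.
Let S0 : (0 < #|{: tuples}|)%N. Proof. exact: card_finZmod_gt0. Qed.

Lemma ler_mean_mismatch r (f : 'I_#|G| -> R) a b : a <= b ->
  (forall i, f i <= b) -> (forall i, matches_order m r (lam i) -> f i <= a) ->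
  mean f <= a + (b - a) * mismatch r.
Proof.
move=> ab fb fa; rewrite -[X in X + _](mean_cst I0) -meanZ -meanD.
apply: ler_mean => i; have [good|_] := boolP (matches_order _ _ _).
  by rewrite mulr0 addr0 fa.
by rewrite mulr1 addrC subrK.
Qed.

(** A mismatched character is killed by some exponent [e <= r] that does not
    kill elements of order [m]; by [card_trivial_pow] such characters are
    counted by the [e]-torsion of [G]. *)
Lemma mismatch_le r :
  (forall e, (e <= r)%N -> order_dvd m e -> forall x : G, x *+ e = 0) ->
  mismatch r <= \sum_(e < r.+1 | ~~ order_dvd m e)
                  #|[set x : G | x *+ e == 0]%SET|%:R / #|G|%:R.
Proof.
move=> hm.
have E e : #|[set x : G | x *+ e == 0]%SET|%:R / #|G|%:R =
    mean (fun i => (trivial_pow (lam i) e)%:R) :> R.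
  by rewrite mean_pred card_ord -(card_trivial_pow lam_char lam_trace).
under eq_bigr do rewrite E.
rewrite -mean_sum; apply: ler_mean => i.
have [good|] := boolP (matches_order _ _ _); first by rewrite sumr_ge0.
rewrite negb_forall => /existsP[e he].
have [oe|oe] := boolP (order_dvd m e).
  case/negP: he; rewrite oe; apply/eqP/forallP => x.
  by rewrite -charX// hm// ?(lam_char i).1// -ltnS.
move: he; rewrite (negPf oe); case te : (trivial_pow _ _) => // _.
by rewrite (bigD1 e)//= te lerDl sumr_ge0.
Qed.

Definition spectral_mean (p : {poly R}) (s : tuples) : R :=
  mean (fun i => p.[cabs (csum (lam i) s) ^+ 2]).

(** The deviation is nonnegative by [moment_over_dual_ge], so its mean is a
    difference of means; after exchanging the averages, matching characters
    contribute exactly the limit moment. *)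
Lemma moment_deviation r (chi : G -> R[i]) :
  is_char chi -> matches_order m r chi ->
  (forall e, (e <= r)%N -> order_dvd m e -> forall x : G, x *+ e = 0) ->
  mean (fun s : tuples =>
    `|mean (fun i => cabs (csum (lam i) s) ^+ r.*2) - abs_moment R m d r|)
  <= d%:R ^+ r.*2 * mismatch r.
Proof.
move=> chic good hm.
have TE (chi' : G -> R[i]) : is_char chi' -> matches_order m r chi' ->
    mean (fun s : tuples => cabs (csum chi' s) ^+ r.*2) = abs_moment R m d r.
  by move=> c' g'; rewrite /abs_moment (abs_moment_char c' g').
rewrite (eq_mean (g := fun s : tuples =>
  mean (fun i => cabs (csum (lam i) s) ^+ r.*2) - abs_moment R m d r)); last first.
  move=> s; rewrite ger0_norm// subr_ge0 -(TE _ chic good).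
  exact: (moment_over_dual_ge s lam_char lam_trace chic good hm).
rewrite meanB mean_cst// mean_exchange lerBlDl.
have bnd i : mean (fun s : tuples => cabs (csum (lam i) s) ^+ r.*2) <= d%:R ^+ r.*2.
  rewrite -[leRHS](mean_cst S0); apply: ler_mean => s.
  by rewrite lerXn2r ?nnegrE ?cabs_ge0// cabs_csum_le.
have T0 : 0 <= abs_moment R m d r.
  by rewrite -(TE _ chic good); apply: mean_ge0 => s; rewrite exprn_ge0 ?cabs_ge0.
apply: le_trans (@ler_mean_mismatch r _ (abs_moment R m d r) (d%:R ^+ r.*2) _ bnd _) _.
- rewrite -(TE _ chic good) -[leRHS](mean_cst S0); apply: ler_mean => s.
  by rewrite lerXn2r ?nnegrE ?cabs_ge0// cabs_csum_le.
- by move=> i gi; rewrite TE.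
- by rewrite lerD2l ler_wpM2r ?mismatch_ge0// gerBl.
Qed.

Lemma spectral_mean_deviation (p : {poly R}) (chi : G -> R[i]) :
  is_char chi -> matches_order m (size p) chi ->
  (forall e, (e <= size p)%N -> order_dvd m e -> forall x : G, x *+ e = 0) ->
  mean (fun s => `|spectral_mean p s - poly_mean m d p|)
  <= (\sum_(r < size p) `|p`_r| * d%:R ^+ r.*2) * mismatch (size p).
Proof.
move=> chic good hm.
pose D r (s : tuples) :=
  mean (fun i => cabs (csum (lam i) s) ^+ r.*2) - abs_moment R m d r.
apply: le_trans (_ : _ <= mean (fun s => \sum_(r < size p) `|p`_r| * `|D r s|)) _.
  apply: ler_mean => s.
  have -> : spectral_mean p s - poly_mean m d p = \sum_(r < size p) p`_r * D r s.
    rewrite /spectral_mean (eq_mean (g := fun i =>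
      \sum_(r < size p) p`_r * cabs (csum (lam i) s) ^+ r.*2)); last first.
      by move=> i; rewrite horner_coef; apply: eq_bigr => r _; rewrite -exprM mul2n.
    rewrite mean_sum /poly_mean -sumrB; apply: eq_bigr => r _.
    by rewrite meanZ -mulrBr.
  apply: le_trans (ler_norm_sum _ _ _) _.
  by apply: ler_sum => r _; rewrite normrM.
rewrite mean_sum mulr_suml; apply: ler_sum => r _.
rewrite meanZ -mulrA ler_wpM2l//.
have rp : (r <= size p)%N by apply: ltnW.
apply: le_trans (moment_deviation chic (matches_order_le rp good) _) _.
  by move=> e er; apply: hm; apply: leq_trans er rp.
rewrite ler_wpM2l ?exprn_ge0//; apply: ler_mean => i.
have [gp|_] := boolP (matches_order m (size p) _); last by rewrite lern1 leq_b1.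
by rewrite (matches_order_le rp gp).
Qed.

End concentration.

(** * Small balls *)

Section small_balls.
Variables (R : realType) (G : finZmodType) (chi : G -> R[i]) (k : nat).
Hypotheses (chi_char : is_char chi)
  (chi_order : forall e, trivial_pow chi e = (k %| e)%N).

Local Notation pr P := (mean (fun x => (P x)%:R : R)).

Let G0 : (0 < #|G|)%N. Proof. exact: card_finZmod_gt0. Qed.

Lemma mean_shift (f : G -> R) (y : G) : mean (fun x => f (x - y)) = mean f.
Proof.
rewrite /mean [in RHS](reindex_inj (addIr (- y))) /=.
by congr (_ * _).
Qed.

Lemma cabs_unit_powB (w : R[i]) j : cabs w = 1 ->
  cabs (w ^+ j - 1) <= j%:R * cabs (w - 1).
Proof.
move=> w1; rewrite subrX1 cabsM mulrC ler_wpM2r ?cabs_ge0//.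
apply: le_trans (cabs_sum _ _ _) _.
by rewrite (eq_bigr (fun=> 1)) ?sumr_const ?card_ord// => i _; rewrite cabsX w1 expr1n.
Qed.

(** Parseval: the first [M] powers of [chi] are distinct characters. *)
Lemma fejer_mean M : (0 < M <= k)%N ->
  mean (fun x => cabs (\sum_(j < M) chi x ^+ j) ^+ 2) = M%:R.
Proof.
move=> /andP[M0 Mk]; apply: (@complexI R).
rewrite /mean rmorphM fmorphV /= !rmorph_nat rmorph_sum /=.
have N0 : #|G|%:R != 0 :> R[i] by rewrite pnatr_eq0 -lt0n.
apply: (mulfI N0); rewrite mulVKf//.
have E x : (cabs (\sum_(j < M) chi x ^+ j) ^+ 2)%:C%C =
    \sum_(i < M) \sum_(j < M) chi x ^+ i * chi (- x) ^+ j.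
  rewrite cabs_sqr rmorph_sum /= mulr_suml; apply: eq_bigr => i _.
  by rewrite mulr_sumr; apply: eq_bigr => j _; rewrite rmorphXn /= conj_char.
rewrite (eq_bigr _ (fun x _ => E x)) exchange_big /=.
rewrite (eq_bigr (fun=> #|G|%:R)); first by rewrite sumr_const card_ord mulr_natr.
move=> i _; rewrite exchange_big (bigD1 i)//= [X in _ + X]big1 ?addr0.
  rewrite (eq_bigr (fun=> 1)) ?sumr_const// => x _.
  by rewrite charN// exprVn divff// expf_neq0// char_neq0.
move=> j ji.
have cij : is_char (fun x => chi x ^+ i * chi (- x) ^+ j).
  split=> [|x y]; first by rewrite oppr0 chi_char.1 !expr1n mulr1.
  by rewrite opprD !chi_char.2 !exprMn mulrACA.
rewrite (char_sum cij); case: forallP => // triv; exfalso.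
have tr x : chi x ^+ i = chi x ^+ j.
  have /eqP := triv x; rewrite charN// exprVn => h.
  have n0 : chi x ^+ j != 0 by rewrite expf_neq0// char_neq0.
  by rewrite -[LHS](mulfVK n0) h mul1r.
have key (a b : 'I_M) : (a < b)%N -> (forall x, chi x ^+ a = chi x ^+ b) -> False.
  move=> ab h; have : trivial_pow chi (b - a).
    apply/forallP => x; apply/eqP.
    have n0 : chi x ^+ a != 0 by rewrite expf_neq0// char_neq0.
    by apply: (mulfI n0); rewrite -exprD subnKC ?(ltnW ab)// mulr1 h.
  rewrite chi_order => /dvdn_leq; rewrite subn_gt0 => /(_ ab).
  by rewrite leqNgt (leq_ltn_trans (leq_subr _ _))// (leq_trans (ltn_ord b)).
case: (ltngtP i j) => [ij|ij|/val_inj ij]; first exact: (key _ _ ij tr).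
  by apply: (key _ _ ij) => x.
by rewrite ij eqxx in ji.
Qed.

(** If [chi x] and [chi x0] lie in the ball, then [chi (x - x0)] is so close to 1
    that the geometric sum of length [M] at [x - x0] has modulus at least
    [M / 2]; its mean square is only [M]. *)
Lemma ball_mean_le M (a : R[i]) : (0 < M <= k)%N ->
  pr (fun x => cabs (chi x - a) < (4 * M%:R)^-1) <= 4 / M%:R.
Proof.
move=> Mk; have /andP[M0 _] := Mk.
have M0' : 0 < M%:R :> R by rewrite ltr0n.
case: (pickP (fun x => cabs (chi x - a) < (4 * M%:R)^-1)) => [x0 hx0|none]; last first.
  rewrite (eq_mean (g := fun=> 0)) ?mean_cst ?divr_ge0// ?ltW//.
  by move=> x; rewrite none.
pose f x := cabs (\sum_(j < M) chi x ^+ j) ^+ 2.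
have : mean (fun x => M%:R ^+ 2 / 4 * (cabs (chi x - a) < (4 * M%:R)^-1)%R%:R) <=
    mean (fun x => f (x - x0)).
  apply: ler_mean => x; case: ltP => hx; last by rewrite mulr0 exprn_ge0 ?cabs_ge0.
  rewrite mulr1 /f; set t := x - x0.
  have ht : cabs (chi t - 1) <= (2 * M%:R)^-1.
    have -> : chi t - 1 = (chi x - chi x0) * chi (- x0).
      by rewrite mulrBl -!chi_char.2 subrr chi_char.1.
    rewrite cabsM cabs_char// mulr1.
    have -> : chi x - chi x0 = (chi x - a) - (chi x0 - a) by rewrite opprB addrA subrK.
    apply: le_trans (cabsB _ _) _; apply: le_trans (lerD (ltW hx) (ltW hx0)) _.
    have -> : (2 * M%:R)^-1 = (4 * M%:R)^-1 + (4 * M%:R)^-1 :> R; last by [].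
    by field; rewrite gt_eqF.
  have hs : M%:R / 2 <= cabs (\sum_(j < M) chi t ^+ j).
    have E : (M%:R : R[i]) = \sum_(j < M) chi t ^+ j - \sum_(j < M) (chi t ^+ j - 1).
      by rewrite sumrB subKr sumr_const card_ord.
    have h1 : cabs (\sum_(j < M) (chi t ^+ j - 1)) <= M%:R / 2.
      apply: le_trans (cabs_sum _ _ _) _.
      apply: le_trans (_ : _ <= \sum_(j < M) (2^-1 : R)) _; last first.
        by rewrite sumr_const card_ord -[_ *+ M]mulr_natl lexx.
      apply: ler_sum => j _; apply: le_trans (cabs_unit_powB _ (cabs_char chi_char _)) _.
      apply: le_trans (ler_wpM2l (ler0n _ _) ht) _.
      rewrite invfM mulrCA ler_piMr ?invr_ge0//.
      by rewrite ler_pdivrMr// mul1r ler_nat ltnW.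
    have := cabsB (\sum_(j < M) chi t ^+ j) (\sum_(j < M) (chi t ^+ j - 1)).
    rewrite -E cabs_natr; lra.
  have -> : M%:R ^+ 2 / 4 = (M%:R / 2) ^+ 2 :> R by field.
  by rewrite lerXn2r ?nnegrE ?cabs_ge0// divr_ge0// ltW.
rewrite mean_shift fejer_mean// meanZ => h.
rewrite ler_pdivlMr// -(ler_pM2r (_ : 0 < M%:R / 4)) ?divr_gt0//.
apply: le_trans (_ : _ <= M%:R) _; last by rewrite mulrC mulfVK.
by apply: le_trans h; rewrite le_eqVlt; apply/orP; left; apply/eqP; field.
Qed.

Lemma mean_csum_recl n (F : R[i] -> R) :
  mean (fun s : {ffun 'I_n.+1 -> G} => F (csum chi s)) =
  mean (fun s : {ffun 'I_n -> G} => mean (fun x => F (chi x + csum chi s))).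
Proof.
rewrite mean_dffun_recl mean_exchange; apply: eq_mean => s; apply: eq_mean => x.
rewrite /csum big_ord_recl ffunE unlift_none /=; congr (F (_ + _)).
by apply: eq_bigr => j _; rewrite ffunE liftK.
Qed.

(** Given the other terms, the first one has to fall into a ball. *)
Lemma csum_ball_mean_le n M : (0 < M <= k)%N ->
  pr (fun s : {ffun 'I_n.+1 -> G} => cabs (csum chi s) < (4 * M%:R)^-1) <= 4 / M%:R.
Proof.
move=> Mk; rewrite (mean_csum_recl n (fun z => (cabs z < (4 * M%:R)^-1)%R%:R)).
rewrite -[leRHS](@mean_cst R {ffun 'I_n -> G}) ?card_finZmod_gt0//.
apply: ler_mean => s; rewrite -[csum chi s]opprK; exact: ball_mean_le.
Qed.

Lemma quadratic_split (a b c : R[i]) : a != 0 ->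
  exists p q : R[i], forall w, a * w ^+ 2 + b * w + c = a * ((w - p) * (w - q)).
Proof.
move=> a0; pose D := sqrtC (b ^+ 2 - 4 * a * c).
have D2 : D ^+ 2 = b ^+ 2 - 4 * a * c by rewrite sqrtCK.
exists ((- b + D) / (2 * a)), ((- b - D) / (2 * a)) => w.
have -> : a * ((w - (- b + D) / (2 * a)) * (w - (- b - D) / (2 * a))) =
  a * w ^+ 2 + b * w + (b ^+ 2 - D ^+ 2) / (4 * a) by field.
by rewrite D2; field.
Qed.

(** Write the sum as [w + v] with [w] a single term. If [|v|] is not small, then
    [w * (|w + v|^2 - 1)] is a quadratic polynomial in [w], so [w] is close to
    one of its two roots; if [|v|] is small, the sum of the other terms lies in
    a small ball. The radius is chosen so that each of the three events has
    probability at most [4 / M]. *)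
Lemma near_unit_circle_mean_le n M : (0 < M <= k)%N ->
  pr (fun s : {ffun 'I_n.+2 -> G} => `|cabs (csum chi s) - 1| < (192 * M%:R ^+ 3)^-1)
    <= 12 / M%:R.
Proof.
move=> Mk; have /andP[M0 _] := Mk; have M1 : 1 <= M%:R :> R by rewrite ler1n.
have M0' : 0 < M%:R :> R by rewrite ltr0n.
set th := (192 * _)^-1; pose r : R := (4 * M%:R)^-1.
have r0 : 0 < r by rewrite invr_gt0 mulr_gt0.
(* The factor 3 will bound [|w + v| + 1], and [r ^+ 3] bounds from below the
   product of [|v|] with the distances from [w] to the two roots. *)
have thr : 3 * th = r ^+ 3 by rewrite /th /r; field; rewrite gt_eqF.
have th1 : th <= 1.
  have r1 : r <= 1 by rewrite invf_le1 ?mulr_gt0//; lra.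
  have : r ^+ 3 <= 1 by rewrite exprn_ile1// ltW.
  lra.
rewrite (mean_csum_recl n.+1 (fun z => (`|cabs z - 1| < th)%R%:R)).
have -> : 12 / M%:R = 8 / M%:R + 4 / M%:R :> R by field; rewrite gt_eqF.
apply: le_trans (_ : _ <= 8 / M%:R + pr (fun s : {ffun 'I_n.+1 -> G} => cabs (csum chi s) < r)) _; last first.
  by rewrite lerD2l csum_ball_mean_le.
rewrite -[X in X + _](@mean_cst R {ffun 'I_n.+1 -> G}) ?card_finZmod_gt0// -meanD.
apply: ler_mean => s; set v := csum chi s; case: ltP => hv.
  have M8 : 0 <= 8 / M%:R :> R by rewrite divr_ge0// ltW.
  apply: le_trans (_ : _ <= 1) _; last by rewrite /=; lra.
  rewrite -[leRHS](@mean_cst R G)//; apply: ler_mean => x.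
  by rewrite lern1 leq_b1.
rewrite addr0; have v0 : v != 0 by rewrite -cabs_eq0 gt_eqF// (lt_le_trans r0).
have vc0 : (v^*)%C != 0 by rewrite conjc_eq0.
have [p [q pq]] := quadratic_split (v * (v^*)%C) v vc0.
have -> : 8 / M%:R = 4 / M%:R + 4 / M%:R :> R by field; rewrite gt_eqF.
apply: le_trans (lerD (ball_mean_le p Mk) (ball_mean_le q Mk)).
rewrite -meanD; apply: ler_mean => x; set w := chi x.
have w1 : cabs w = 1 by rewrite cabs_char.
have w0 : w != 0 by rewrite char_neq0.
case: ltP => [hu|_]; last by rewrite addr_ge0.
rewrite -natrD ler_nat; case: ltP => // hp; case: ltP => // hq; exfalso.
have E : ((cabs (w + v) ^+ 2 - 1)%:C)%C * w = (v^*)%C * ((w - p) * (w - q)).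
  rewrite -pq rmorphB rmorph1 /= cabs_sqr rmorphD /= (conj_unit w1).
  by field.
have : `|cabs (w + v) ^+ 2 - 1| = cabs v * (cabs (w - p) * cabs (w - q)).
  have <- : cabs ((v^*)%C * ((w - p) * (w - q))) = cabs v * (cabs (w - p) * cabs (w - q)).
    rewrite !cabsM; congr (_ * _); apply: (@complexI R); rewrite -!cabsE; exact: normcJ.
  rewrite -E cabsM w1 mulr1; apply: (@complexI R); rewrite -cabsE.
  by rewrite normc_def /= expr0n addr0 sqrtr_sqr.
have : r ^+ 3 <= cabs v * (cabs (w - p) * cabs (w - q)).
  have r0' := ltW r0; rewrite exprS expr2; apply: ler_pM => //; first exact: mulr_ge0.
  by apply: ler_pM.
have : `|cabs (w + v) ^+ 2 - 1| < 3 * th.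
  have -> : cabs (w + v) ^+ 2 - 1 = (cabs (w + v) - 1) * (cabs (w + v) + 1) by ring.
  rewrite normrM mulrC; apply: le_lt_trans (_ : _ <= 3 * `|cabs (w + v) - 1|) _.
    rewrite ler_wpM2r// ger0_norm ?addr_ge0 ?cabs_ge0//.
    by move: hu; rewrite ltr_norml => /andP[_]; lra.
  by rewrite ltr_pM2l.
by rewrite thr; lra.
Qed.
End small_balls.

(** * Lower tail of the logarithm for characters of large order *)

Section tail.
Variable R : realType.
Implicit Types x : R.

(** The radius at which [ball_mean_le] applies with [M = 2^l]. *)
Definition dyadic (l : nat) : R := (4 * (2 ^ l)%N%:R)^-1.

Definition log_excess l x : R := Num.max 0 (ln (dyadic l) - ln x).

Lemma dyadic_gt0 l : 0 < dyadic l.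
Proof. by rewrite invr_gt0 mulr_gt0// ltr0n expn_gt0. Qed.

Lemma ln_dyadicS l : ln (dyadic l.+1) = ln (dyadic l) - ln 2 :> R.
Proof.
rewrite -ln_div ?posrE ?dyadic_gt0//; congr ln.
rewrite /dyadic expnS natrM; field.
by rewrite pnatr_eq0 -lt0n expn_gt0.
Qed.

Lemma dyadic_le4 l : dyadic l <= 4^-1.
Proof.
by rewrite /dyadic invfM ler_piMr ?invr_ge0// invf_le1 ?ltr0n ?expn_gt0// ler1n expn_gt0.
Qed.

Lemma ln_dyadic_le0 l : ln (dyadic l) <= 0.
Proof. by apply: ln_le0; apply: le_trans (dyadic_le4 l) _; lra. Qed.

Lemma ln2_le1 : ln 2 <= 1 :> R.
Proof. by have := @le_ln1Dx R 1; rewrite -[1 + 1]/(2 : R); apply; lra. Qed.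

Lemma ln_dyadic_ge l : - (l%:R + 2) <= ln (dyadic l).
Proof.
elim: l => [|l IH].
  rewrite /dyadic expn0 mulr1 lnV ?posrE// (_ : 4 = 2 ^+ 2 :> R); last by ring.
  by rewrite lnXn// mulr2n; have := ln2_le1; lra.
by rewrite ln_dyadicS -natr1; have := ln2_le1; lra.
Qed.

Lemma log_excess_ge0 l x : 0 <= log_excess l x.
Proof. by rewrite le_max lexx. Qed.

Lemma log_excess_step l x : 0 < x ->
  log_excess l x <= log_excess l.+1 x + ln 2 * (x < dyadic l)%R%:R.
Proof.
move=> x0; rewrite /log_excess ln_dyadicS; have ln20 : 0 <= ln 2 :> R by apply: ln_ge0; lra.
case: ltP => hx.
  rewrite mulr1 ge_max addr_ge0//=; last by rewrite le_max lexx.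
  rewrite -lerBlDr le_max; apply/orP; right; lra.
rewrite mulr0 addr0 (_ : Num.max 0 (ln (dyadic l) - ln x) = 0); first by rewrite le_max lexx.
by apply/max_idPl; rewrite subr_le0 ler_ln ?posrE// dyadic_gt0.
Qed.

Section char_tail.
Variables (G : finZmodType) (chi : G -> R[i]) (k d : nat).
Hypotheses (chi_char : is_char chi)
  (chi_order : forall e, trivial_pow chi e = (k %| e)%N)
  (k0 : (0 < k)%N) (d0 : (0 < d)%N)
  (nonvanishing : ~ sumset d (roots_of_unity R k) 0).
Local Notation tuples := {ffun 'I_d -> G}.
Implicit Types s : tuples.

Let chik (y : G) : chi y ^+ k = 1.
Proof. by have /forallP/(_ y)/eqP := etrans (chi_order k) (dvdnn k). Qed.

Lemma cabs_csum_gt0 s : 0 < cabs (csum chi s).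
Proof.
rewrite lt_neqAle cabs_ge0 andbT eq_sym cabs_eq0; apply/eqP => E.
by apply: nonvanishing; exists (fun j => chi (s j)) => // j; exact: chik.
Qed.

Lemma ln_cabs_csum_ge s : - (k.-1%:R * ln d%:R) <= ln (cabs (csum chi s)).
Proof.
have := sum_unity_lower_bound k0 nonvanishing (fun j => chik (s j)).
rewrite -/(csum chi s) => h; have d0' : 0 < d%:R :> R by rewrite ltr0n.
have := ln_ge0 h; rewrite lnM ?posrE ?cabs_csum_gt0 ?exprn_gt0// lnXn// -mulr_natl.
by lra.
Qed.

(** Passing to the next scale costs [ln 2] on an event of probability [4 / 2^l],
    as long as [2^l] is at most the order [k]; the costs form a geometric
    series. *)
Lemma mean_log_excess l n : (2 ^ (l + n) <= k)%N ->
  mean (fun s => log_excess l (cabs (csum chi s))) <=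
  mean (fun s => log_excess (l + n) (cabs (csum chi s))) +
    8 * ln 2 * ((2 ^ l)%N%:R^-1 - (2 ^ (l + n))%N%:R^-1).
Proof.
have d1 := prednK d0.
elim: n => [|n IH] hk; first by rewrite addn0 subrr mulr0 addr0.
have hk' : (2 ^ (l + n) <= k)%N by apply: leq_trans hk; rewrite leq_exp2l// leq_add2l.
apply: le_trans (IH hk') _; rewrite addnS.
have ln20 : 0 <= ln 2 :> R by apply: ln_ge0; lra.
have h1 : mean (fun s => log_excess (l + n) (cabs (csum chi s))) <=
    mean (fun s => log_excess (l + n).+1 (cabs (csum chi s))) +
      ln 2 * mean (fun s => (cabs (csum chi s) < dyadic (l + n))%R%:R).
  by rewrite -meanZ -meanD; apply: ler_mean => s; exact/log_excess_step/cabs_csum_gt0.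
have h2 : mean (fun s => (cabs (csum chi s) < dyadic (l + n))%R%:R) <=
    4 / (2 ^ (l + n))%N%:R :> R.
  have M0 : (0 < 2 ^ (l + n) <= k)%N by rewrite expn_gt0.
  rewrite /dyadic; move: (@csum_ball_mean_le _ _ _ _ chi_char chi_order d.-1 _ M0).
  by rewrite d1.
have := ler_wpM2l ln20 h2; rewrite expnS natrM invfM.
set q := (2 ^ _)%N%:R^-1; set q' := _^-1 in h1 h2 *; lra.
Qed.

End char_tail.
End tail.

Section tail_end.
Variable R : realType.
Variables (G : finZmodType) (chi : G -> R[i]) (k : nat).
Hypotheses (chi_char : is_char chi)
  (chi_order : forall e, trivial_pow chi e = (k %| e)%N) (k0 : (0 < k)%N).

Let chik (y : G) : chi y ^+ k = 1.
Proof. by have /forallP/(_ y)/eqP := etrans (chi_order k) (dvdnn k). Qed.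

Let L := trunc_log 2 k.

Let Lk : (2 ^ L <= k)%N.
Proof. by rewrite trunc_logP. Qed.

Let kL : (k < 2 ^ L.+1)%N.
Proof. by rewrite trunc_log_ltn. Qed.

Lemma log_excess_ge_dyadic l (x : R) : 0 < x -> dyadic R l <= x -> log_excess l x = 0.
Proof.
by move=> x0 h; apply/max_idPl; rewrite subr_le0 ler_ln ?posrE// dyadic_gt0.
Qed.

Lemma log_excess_end1 (s : {ffun 'I_1 -> G}) : log_excess L (cabs (csum chi s)) = 0.
Proof.
rewrite /csum big_ord1 log_excess_ge_dyadic ?cabs_char//.
by apply: le_trans (dyadic_le4 R L) _; lra.
Qed.

(** The single remaining term has modulus 1, so the general argument for many
    terms fails. But non-vanishing forces [k] to be odd, hence
    [y = - chi (s 1) / chi (s 0)] satisfies [y^k = -1], and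
    [2 = |y^k - 1| <= k * |y - 1|]. *)
Lemma log_excess_end2 (s : {ffun 'I_2 -> G}) :
  ~ sumset 2 (roots_of_unity R k) 0 -> log_excess L (cabs (csum chi s)) = 0.
Proof.
move=> h0; have kodd : odd k.
  rewrite -[odd k]negbK; apply/negP => keven; apply: h0.
  exists (fun j : 'I_2 => (-1) ^+ j) => [j|].
    by rewrite /roots_of_unity /= exprAC -signr_odd (negPf keven) expr1n.
  by rewrite !big_ord_recl big_ord0 /= expr0 expr1 addr0 subrr.
have sz : 0 < cabs (csum chi s) by exact: (cabs_csum_gt0 chi_order h0).
apply: log_excess_ge_dyadic => //.
pose y := - chi (s (lift ord0 ord0)) / chi (s ord0).
have y1 : cabs y = 1 by rewrite cabsM cabsN -charN// !cabs_char// mulr1.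
have yk : y ^+ k = -1.
  by rewrite expr_div_n exprNn !chik -signr_odd kodd expr1 divr1 mulr1.
have zE : cabs (csum chi s) = cabs (y - 1).
  rewrite /csum !big_ord_recl big_ord0 addr0.
  have n0 := char_neq0 chi_char (s ord0).
  have -> : chi (s ord0) + chi (s (lift ord0 ord0)) = - (chi (s ord0) * (y - 1)).
    by rewrite /y; field.
  by rewrite cabsN cabsM cabs_char// mul1r.
have : 2 <= k%:R * cabs (y - 1).
  apply: le_trans (cabs_unit_powB k y1); rewrite yk.
  by rewrite -opprD cabsN -[1 + 1]/(2%:R) cabs_natr.
rewrite -zE => h; rewrite /dyadic.
have k0' : 0 < k%:R :> R by rewrite ltr0n.
have h2 : k%:R <= 2 * (2 ^ L)%N%:R :> R.
  by rewrite -natrM ler_nat -expnS ltnW.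
have q0 : 0 < (2 ^ L)%N%:R :> R by rewrite ltr0n expn_gt0.
rewrite -div1r ler_pdivrMr ?mulr_gt0//.
have : k%:R * cabs (csum chi s) <= 2 * (2 ^ L)%N%:R * cabs (csum chi s).
  by rewrite ler_wpM2r ?cabs_ge0.
by lra.
Qed.

(** Below the scale [1 / k], integrality bounds the excess by [k * ln d]. The
    event has probability [O(1 / k)] times that of the remaining sum having
    modulus close to 1, which is small because at least two terms remain. *)
Lemma mean_log_excess_end3 n M : (0 < M)%N -> (96 * M ^ 3 <= k)%N ->
  ~ sumset n.+3 (roots_of_unity R k) 0 ->
  mean (fun s : {ffun 'I_n.+3 -> G} => log_excess L (cabs (csum chi s)))
    <= 96 * ln n.+3%:R / M%:R.
Proof.
move=> M0 Mk h0; set D := ln _.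
have D0 : 0 <= D by apply: ln_ge0; rewrite ler1n.
have M0' : 0 < M%:R :> R by rewrite ltr0n.
have q0 : 0 < (2 ^ L)%N%:R :> R by rewrite ltr0n expn_gt0.
have Mk' : (0 < M <= k)%N.
  rewrite M0; apply: leq_trans Mk; apply: leq_trans (leq_pmull _ _) => //.
  by rewrite -[X in (X <= _)%N]expn1 leq_pexp2l.
have step1 (s : {ffun 'I_n.+3 -> G}) : log_excess L (cabs (csum chi s)) <=
    k%:R * D * (cabs (csum chi s) < dyadic R L)%R%:R.
  have sz : 0 < cabs (csum chi s) by exact: (cabs_csum_gt0 chi_order h0).
  case: ltP => hs; last by rewrite mulr0 log_excess_ge_dyadic.
  rewrite mulr1 ge_max mulr_ge0//=.
  have h1 := ln_cabs_csum_ge chi_order k0 (ltn0Sn _) h0 s.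
  have h2 := ln_dyadic_le0 R L.
  have h3 : k.-1%:R * D <= k%:R * D by rewrite ler_wpM2r// ler_nat leq_pred.
  by move: h1; rewrite -/D; lra.
apply: le_trans (ler_mean step1) _; rewrite meanZ.
have step2 : mean (fun s : {ffun 'I_n.+3 -> G} => (cabs (csum chi s) < dyadic R L)%R%:R)
    <= 4 / (2 ^ L)%N%:R * (12 / M%:R) :> R.
  rewrite [leLHS](mean_csum_recl chi n.+2 (fun z => (cabs z < dyadic R L)%R%:R : R)).
  apply: le_trans (_ : _ <= 4 / (2 ^ L)%N%:R *
    mean (fun s : {ffun 'I_n.+2 -> G} => (`|cabs (csum chi s) - 1| < dyadic R L)%R%:R)) _.
    rewrite -meanZ; apply: ler_mean => s; set u := csum chi s.
    have M1 : (0 < 2 ^ L <= k)%N by rewrite expn_gt0.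
    case: ltP => hu.
      rewrite mulr1 -[u]opprK; exact: (ball_mean_le chi_char chi_order (- u) M1).
    rewrite mulr0 (eq_mean (g := fun=> 0)) ?mean_cst ?card_finZmod_gt0// => x.
    case: ltP => // hx; have : `|cabs u - 1| <= cabs (chi x + u).
      rewrite ler_norml; apply/andP; split.
        have := cabsB (chi x + u) u; rewrite addrK cabs_char//; lra.
      have := cabsB (chi x + u) (chi x); rewrite addrAC subrr add0r cabs_char//; lra.
    by move/(le_trans hu); rewrite leNgt hx.
  apply: ler_wpM2l; first by rewrite divr_ge0 ?(ltW q0).
  apply: le_trans (near_unit_circle_mean_le chi_char chi_order n Mk').
  apply: ler_mean => s; case: ltP => // hs.
  rewrite (_ : (_ < _)%R = true)//; apply: lt_le_trans hs _.
  rewrite /dyadic lef_pV2 ?posrE ?mulr_gt0 ?exprn_gt0//.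
  rewrite -natrX -!natrM ler_nat.
  have : (96 * M ^ 3 < 2 ^ L.+1)%N by apply: leq_ltn_trans Mk kL.
  by rewrite (expnS 2 L); move: (2 ^ L)%N (M ^ 3)%N => a b; lia.
apply: le_trans (ler_wpM2l (mulr_ge0 (ler0n _ _) D0) step2) _.
have hk : k%:R <= 2 * (2 ^ L)%N%:R :> R by rewrite -natrM ler_nat -expnS ltnW.
have -> : 96 * D / M%:R = 2 * (2 ^ L)%N%:R * (D * (4 / (2 ^ L)%N%:R * (12 / M%:R))).
  by field; rewrite !gt_eqF.
rewrite -[leLHS]mulrA ler_wpM2r// !mulr_ge0 ?invr_ge0// ltW//.
Qed.

End tail_end.

Lemma exists_nat_ge (R : realType) (x : R) : exists2 n : nat, (0 < n)%N & x <= n%:R.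
Proof.
exists (Num.trunc `|x|).+1 => //; apply: le_trans (ler_norm x) _.
by apply: ltW; rewrite truncnS_gt.
Qed.

(** Outside the ball of radius [dyadic l] the truncation error is uniformly
    small. Inside it is at most [ln d - ln |z|], that is [ln d - ln (dyadic l)] on
    an event of probability [4 / 2^l], plus the excess at scale [l]. *)
Lemma tail_bound (R : realType) (d : nat) (delta : R) : (0 < d)%N -> 0 < delta ->
  exists J0 K : nat, forall J, (J0 <= J)%N ->
  forall (G : finZmodType) (chi : G -> R[i]) (k : nat),
    is_char chi -> (forall e, trivial_pow chi e = (k %| e)%N) ->
    (0 < k)%N -> (K <= k)%N -> ~ sumset d (roots_of_unity R k) 0 ->
  mean (fun s : {ffun 'I_d -> G} =>
    (log_poly d J).[cabs (csum chi s) ^+ 2] - ln (cabs (csum chi s))) <= delta.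
Proof.
move=> d0 del0; set C : R := ln d%:R.
have C0 : 0 <= C by apply: ln_ge0; rewrite ler1n.
have d0' : 0 < d%:R :> R by rewrite ltr0n.
have [M M0 hM] := exists_nat_ge (96 * C * 4 / delta).
have [q qpos hq] := exists_nat_ge (4 * (C + 4) * 4 / delta).
have M0' : 0 < M%:R :> R by rewrite ltr0n.
(* With [l = 2 * q], one factor [2 ^ q >= q + 1] of [2 ^ l] absorbs the linear
   growth of [- ln (dyadic l)] in [l], and the other one gives the decay. *)
pose l := (2 * q)%N; have dy0 := dyadic_gt0 R l.
have dy1 : dyadic R l <= 1 by apply: le_trans (dyadic_le4 R l) _; lra.
have del4 : 0 < delta / 4 by rewrite divr_gt0.
have [J0 hJ0] := log_poly_cvg_uniform d0 (introT andP (conj dy0 dy1)) del4.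
exists J0, (maxn (96 * M ^ 3) (2 ^ l))%N => J JJ G chi k chic chio k0.
rewrite geq_max => /andP[kM kl] h0.
have pos (s : {ffun 'I_d -> G}) : 0 < cabs (csum chi s) by exact: (cabs_csum_gt0 chio h0).
set L := trunc_log 2 k.
have lL : (l <= L)%N by rewrite trunc_log_max.
have endL : mean (fun s : {ffun 'I_d -> G} => log_excess L (cabs (csum chi s))) <= delta / 4.
  have hM' : 96 * ln d%:R * 4 / delta <= M%:R := hM.
  case: (d) d0 hM' h0 => [//|[|[|n]]] _ {}hM {}h0.
  - rewrite (eq_mean (g := fun=> 0)) ?mean_cst ?card_finZmod_gt0// ?divr_ge0// ?ltW//.
    by move=> s; exact: log_excess_end1.
  - rewrite (eq_mean (g := fun=> 0)) ?mean_cst ?card_finZmod_gt0// ?divr_ge0// ?ltW//.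
    by move=> s; exact: (log_excess_end2 chic chio k0).
  apply: le_trans (mean_log_excess_end3 chic chio k0 M0 kM h0) _.
  move: hM; rewrite ler_pdivrMr// => hM.
  by rewrite ler_pdivrMr//; lra.
have stepl := mean_log_excess chic chio d0 h0 (l := l) (n := (L - l)%N).
rewrite subnKC// trunc_logP// in stepl; have {}stepl := stepl isT.
have ball : mean (fun s : {ffun 'I_d -> G} => (cabs (csum chi s) < dyadic R l)%R%:R) <=
    4 / (2 ^ l)%N%:R :> R.
  have M1 : (0 < 2 ^ l <= k)%N by rewrite expn_gt0.
  by move: (csum_ball_mean_le chic chio d.-1 M1); rewrite (prednK d0).
have lndy := ln_dyadic_ge R l; have lndy0 := ln_dyadic_le0 R l.
have ptw (s : {ffun 'I_d -> G}) :
    (log_poly d J).[cabs (csum chi s) ^+ 2] - ln (cabs (csum chi s)) <=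
    delta / 4 + (C - ln (dyadic R l)) * (cabs (csum chi s) < dyadic R l)%R%:R
    + log_excess l (cabs (csum chi s)).
  have xd := cabs_csum_le chic s; move: (pos s) xd; set x := cabs _ => x0 xd.
  have e0 := log_excess_ge0 l x; case: ltP => hx.
    have h1 : (log_poly d J).[x ^+ 2] <= C.
      apply: log_poly_le => //; rewrite exprn_ge0 ?(ltW x0)//=.
      by rewrite lerXn2r ?nnegrE ?(ltW x0) ?(ltW d0').
    have h2 : ln (dyadic R l) - ln x <= log_excess l x by rewrite le_max lexx orbT.
    by rewrite mulr1; lra.
  by rewrite mulr0 addr0; have := hJ0 _ JJ x (introT andP (conj hx xd)); lra.
apply: le_trans (ler_mean ptw) _; rewrite !meanD mean_cst ?card_finZmod_gt0// meanZ.
have Cl : 0 <= C - ln (dyadic R l) by rewrite subr_ge0 (le_trans lndy0).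
have hb := ler_wpM2l Cl ball.
set Q := (2 ^ l)%N%:R in ball stepl hb *; set QL := (2 ^ L)%N%:R in stepl.
have Q0 : 0 < Q by rewrite ltr0n expn_gt0.
have QL0 : 0 <= QL^-1 by rewrite invr_ge0 ler0n.
have ln20 : 0 <= ln 2 :> R by apply: ln_ge0; lra.
have ln21 := ln2_le1 R.
have small : 4 * (C + l%:R + 4) / Q <= delta / 4.
  have q0 : 0 < q%:R :> R by rewrite ltr0n.
  have QE : Q = (2 ^ q)%N%:R * (2 ^ q)%N%:R by rewrite -natrM -expnD addnn -mul2n.
  have q2 : q%:R + 1 <= (2 ^ q)%N%:R :> R by rewrite natr1 ler_nat ltn_expl.
  have h1 : 4 * (C + l%:R + 4) <= 4 * (C + 4) * (2 ^ q)%N%:R.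
    rewrite natrM -mulrA ler_wpM2l//; apply: le_trans (_ : _ <= (C + 4) * (q%:R + 1)) _.
      have : 0 <= C * q%:R by rewrite mulr_ge0// ltW.
      by lra.
    by rewrite ler_wpM2l// addr_ge0.
  rewrite ler_pdivrMr// (le_trans h1)// QE mulrA ler_wpM2r//.
  move: hq; rewrite ler_pdivrMr// => hq.
  have : delta * (q%:R + 1) <= delta * (2 ^ q)%N%:R by rewrite ler_wpM2l// ltW.
  by lra.
have Qi : 0 < Q^-1 by rewrite invr_gt0.
have a1 : (C - ln (dyadic R l)) * (4 / Q) <= (C + (l%:R + 2)) * (4 / Q).
  by rewrite ler_wpM2r ?divr_ge0 ?(ltW Q0)//; lra.
have a2 : 8 * ln 2 * (Q^-1 - QL^-1) <= 8 * Q^-1.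
  have : ln 2 * QL^-1 >= 0 by rewrite mulr_ge0.
  have : ln 2 * Q^-1 <= 1 * Q^-1 by rewrite ler_wpM2r// ltW.
  by lra.
apply: le_trans (lerD (lerD (lexx _) hb) stepl) _.
move: (mean _) endL => E hE; lra.
Qed.

(** * Orders of group elements under weak convergence *)

Lemma continuous_borel_measurable (T : ptopologicalType) (R : realType) (f : T -> R) :
  continuous f -> measurable_fun setT (f : borel T -> R).
Proof.
move=> cf; apply: (measurability _ (RGenOpens.measurableE R)).
move=> _ [U [a [b ->]] <-]; rewrite setTI; apply: sub_sigma_algebra.
by move/continuousP: cf; apply; exact: interval_open.
Qed.

Section order_statistics.
Variable R : realType.

(** For [e > 0] this is the indicator of finitely many isolated points, hence a
    continuous test function vanishing at infinity. *)
Definition order_dvd_ind (e : nat) (y : posN_infty) : R :=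
  if y is Some k then (posN_val k %| e)%N%:R else 0.

Lemma order_dvd_ind_continuous e : (0 < e)%N -> continuous (order_dvd_ind e).
Proof.
(* Finite points are isolated; near infinity, avoid the divisors of [e]. *)
move=> e0 [k|] A /nbhs_singleton Ak.
  have := @one_point_compactification_some_nbhs posN k [set k] (@discrete_set1 posN k).
  move=> h; change (nbhs (Some k : posN_infty) (order_dvd_ind e @^-1` A)).
  refine (@filterS _ (nbhs (Some k : posN_infty)) _ _ _ _ h); by move=> _ [_ -> <-].
exists [set k : posN | (posN_val k %| e)%N].
  split; last exact: discrete_closed.
  apply: finite_compact; apply: (@sub_finite_set _ _ (posN_val @^-1` `I_e.+1)).
    by move=> k /= ke; rewrite ltnS dvdn_leq.
  by apply: finite_preimage; [move=> a b _ _; exact: val_inj|exact: finite_II].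
move=> y [[k /= /negP ke <-]|-> //].
by rewrite /= (negPf ke).
Qed.

Lemma measurable_order_dvd_ind e : (0 < e)%N ->
  measurable_fun setT (fun y : borel posN_infty => (order_dvd_ind e y)%:E).
Proof.
move=> e0; apply/measurable_EFinP.
exact: (continuous_borel_measurable (order_dvd_ind_continuous e0)).
Qed.

Lemma integral_rho_order_dvd (G : finZmodType) (e : nat) : (0 < e)%N ->
  (\int[rho R G]_y (order_dvd_ind e y)%:E =
   (#|[set x : G | x *+ e == 0]%SET|%:R / #|G|%:R)%:E)%E.
Proof.
move=> e0.
rewrite [LHS](_ : _ = \int[mean_dirac R (@ord_G G : G -> borel posN_infty)]_y
  (order_dvd_ind e y)%:E)%E; last by [].
rewrite ge0_integral_mean_dirac; first last.
- by move=> [k|] //=; rewrite lee_fin.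
- exact: measurable_order_dvd_ind.
rewrite sumEFin -EFinM -mean_pred; congr EFin; apply: eq_mean => x.
by rewrite /order_dvd_ind /= /posN_val /= order_dvdn.
Qed.

Lemma weak_cvg_torsion (G : nat -> finZmodType) (m : posN_infty) (e : nat) :
  weak_cvg (fun n => rho R (G n)) (\d_(m : borel posN_infty)) -> (0 < e)%N ->
  (#|[set x : G n | x *+ e == 0]%SET|%:R / #|G n|%:R : R) @[n --> \oo] -->
    ((order_dvd m e)%:R : R).
Proof.
move=> wc e0.
have bf : bounded_fun (order_dvd_ind e).
  exists 1; split => // M M1 [k|] _ /=; last by rewrite normr0 ltW// (lt_trans ltr01).
  by rewrite ger0_norm// (le_trans _ (ltW M1))// lern1 leq_b1.
have := wc _ (order_dvd_ind_continuous e0) bf.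
rewrite integral_dirac//; last first.
  exact: measurable_order_dvd_ind.
rewrite diracT mul1e.
under eq_fun do rewrite integral_rho_order_dvd//.
have -> : order_dvd_ind e m = (order_dvd m e)%:R.
  by case: (m) => [k|] //=; rewrite eqn0Ngt e0.
by move/fine_cvg.
Qed.

(** The [e]-torsion is a subgroup: it is disjoint from its translate by any [y]
    outside it. *)
Lemma torsion_half (G : finZmodType) (e : nat) :
  (#|G| < 2 * #|[set x : G | (x *+ e == 0)%R]%SET|)%N -> forall x : G, x *+ e = 0.
Proof.
move=> h y; apply/eqP/negPn/negP => y0; move: h; rewrite ltnNge => /negP; apply.
set A := [set x : G | x *+ e == 0]%SET.
rewrite -(cardsC A) mul2n -addnn leq_add2l.
rewrite -(card_imset (mem A) (addrI y)); apply/subset_leq_card/fintype.subsetP => x.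
move=> /imsetP[z]; rewrite !inE => /eqP z0 ->.
by rewrite mulrnDl z0 addr0.
Qed.

(** For [e > 0] the proportion of [e]-torsion tends to 1, so it eventually exceeds 1/2. *)
Lemma weak_cvg_torsion_dvd (G : nat -> finZmodType) (m : posN_infty) (e : nat) :
  weak_cvg (fun n => rho R (G n)) (\d_(m : borel posN_infty)) -> order_dvd m e ->
  exists n0, forall n, (n0 <= n)%N -> forall x : G n, x *+ e = 0.
Proof.
move=> wc oe; case: (posnP e) => [->|e0]; first by exists 0%N => n _ x; rewrite mulr0n.
have := weak_cvg_torsion wc e0; rewrite oe => /cvgrPdist_lt /(_ 2^-1).
rewrite invr_gt0 ltr0n => /(_ isT) [n0 _ h]; exists n0 => n nn0; apply: torsion_half.
have := h n nn0; rewrite /= ltr_distlC => /andP[+ _].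
rewrite ltr_pdivlMr ?ltr0n ?card_finZmod_gt0// => h1.
by rewrite -(ltr_nat R) natrM; lra.
Qed.

Lemma weak_cvg_torsion_ndvd (G : nat -> finZmodType) (m : posN_infty) (e : nat) (eps : R) :
  weak_cvg (fun n => rho R (G n)) (\d_(m : borel posN_infty)) -> ~~ order_dvd m e ->
  0 < eps ->
  exists n0, forall n, (n0 <= n)%N ->
    #|[set x : G n | x *+ e == 0]%SET|%:R / #|G n|%:R <= eps.
Proof.
move=> wc oe eps0; have e0 : (0 < e)%N.
  by case: e oe => [|e _] //; case: (m) => [k|] /=; rewrite ?dvdn0 ?eqxx.
have := weak_cvg_torsion wc e0; rewrite (negPf oe) => /cvgrPdist_lt /(_ _ eps0).
move=> [n0 _ h]; exists n0 => n nn0; have := h n nn0.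
by rewrite /= sub0r normrN => /ltW; apply: le_trans; exact: ler_norm.
Qed.

End order_statistics.

(** * From tuples to uniform circulant matrices *)

Section sets_and_tuples.
Variables (R : realType) (G : finZmodType) (d : nat).
Local Notation tuples := {ffun 'I_d -> G}.

Definition set_circulant (S : {set G}) : 'M[R[i]]_#|G| :=
  circulant (fun x => (x \in S)%:R).

Lemma set_circulant_inj : injective set_circulant.
Proof.
move=> S S' E; apply/setP => x.
have /matrixP/(_ (enum_rank x) (enum_rank 0)) := E.
rewrite !mxE !enum_rankK subr0 => /eqP; rewrite eqr_nat.
by case: (x \in S); case: (x \in S').
Qed.

Lemma circulant01_set A : circulant01 R G d A ->
  exists2 S : {set G}, #|S| = d & A = set_circulant S.
Proof.
move=> [[a ->] a01 rows _].
have aE x : a x = (x \in [set y | a y == 1])%SET%:R.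
  rewrite inE; have := a01 (enum_rank x) (enum_rank 0).
  rewrite mxE !enum_rankK subr0 => -[->|->]; last by rewrite eqxx.
  by rewrite eq_sym oner_eq0.
exists [set y | a y == 1]%SET; last first.
  by apply/matrixP => i j; rewrite !mxE -aE.
rewrite -(rows (enum_rank 0)) /circulant.
pose h (x : G) : 'I_#|G| := enum_rank (- x).
have hinj : injective h by move=> x y /enum_rank_inj/oppr_inj.
rewrite -(card_imset _ hinj); apply: eq_card => j; rewrite !inE mxE enum_rankK sub0r.
apply/imsetP/eqP => [[y]|aj].
  by rewrite inE => /eqP ay ->; rewrite enum_rankK opprK.
by exists (- enum_val j); rewrite ?inE ?aj// /h opprK enum_valK.
Qed.

Lemma set_circulant01 (S : {set G}) : #|S| = d -> circulant01 R G d (set_circulant S).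
Proof.
move=> Sd; split.
- by exists (fun x => (x \in S)%:R).
- by move=> i j; rewrite mxE; case: (_ \in S); [right|left].
- move=> i; rewrite -Sd.
  have hinj : injective (fun x : G => enum_rank (enum_val i - x)).
    by move=> x y /enum_rank_inj/addrI/oppr_inj.
  rewrite -[RHS](card_imset _ hinj); apply: eq_card => j; rewrite !inE mxE.
  apply/eqP/imsetP => [/eqP|[x xS ->]].
    rewrite (eqr_nat _ _ 1); case jS : (_ \in S) => // _.
    by exists (enum_val i - enum_val j); rewrite // subKr enum_valK.
  by rewrite enum_rankK subKr xS.
- move=> j; rewrite -Sd.
  have hinj : injective (fun x : G => enum_rank (x + enum_val j)).
    by move=> x y /enum_rank_inj/addIr.
  rewrite -[RHS](card_imset _ hinj); apply: eq_card => i; rewrite !inE mxE.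
  apply/eqP/imsetP => [/eqP|[x xS ->]].
    rewrite (eqr_nat _ _ 1); case iS : (_ \in S) => // _.
    by exists (enum_val i - enum_val j); rewrite // subrK enum_valK.
  by rewrite enum_rankK addrK xS.
Qed.

Lemma circulant01_image :
  circulant01 R G d =
    [set` [fset set_circulant S | S in [set S : {set G} | #|S| == d]%SET]%fset].
Proof.
apply/seteqP; split=> [A /circulant01_set[S Sd ->]|A /= /imfsetP[S /= Sd ->]].
  by apply/imfsetP; exists S => //=; rewrite inE Sd.
by apply: set_circulant01; move: Sd; rewrite inE => /eqP.
Qed.

Lemma card_set_circulant (D : {set {set G}}) :
  #|` [fset set_circulant S | S in D]%fset| = #|D|.
Proof.
rewrite card_imfset; last exact: set_circulant_inj.
by rewrite cardE; apply/perm_size/uniq_perm; rewrite ?enum_finmem_uniq ?enum_uniq.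
Qed.

Lemma tuple_circulant_inj_image (s : tuples) : injective s ->
  tuple_circulant R s = set_circulant [set s j | j : 'I_d]%SET.
Proof.
move=> sinj; congr circulant; apply/funext => x.
case: imsetP => [[j _ ->]|h].
  rewrite (_ : [set k | s k == s j]%SET = [set j]%SET) ?cards1//.
  by apply/setP => k; rewrite !inE (inj_eq sinj).
rewrite (_ : [set k | s k == x]%SET = finset.set0) ?cards0//.
by apply/setP => k; rewrite !inE; apply/eqP => sk; apply: h; exists k.
Qed.

Lemma card_tuples_with_image (S : {set G}) : #|S| = d ->
  #|[set s : tuples | injectiveb s && ([set s j | j : 'I_d]%SET == S)]%SET| = d`!.
Proof.
move=> Sd; have -> : d`! = #|S| ^_ #|'I_d| by rewrite Sd card_ord ffactnn.
rewrite -card_inj_ffuns_on.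
apply: eq_card => s; rewrite !inE andbC; apply: andb_id2r => /injectiveP sinj.
apply/eqP/ffun_onP => [<- j|sS]; first exact: imset_f.
apply/eqP; rewrite eqEcard Sd card_imset// card_ord leqnn andbT.
by apply/fintype.subsetP => _ /imsetP[j _ ->].
Qed.

(** Every set of size [d] is the image of [d`!] injective tuples. *)
Lemma bad_sets_le_bad_tuples (B : pred 'M[R[i]]_#|G|) :
  (#|[set S : {set G} | (#|S| == d) && B (set_circulant S)]%SET| * d`!
   <= #|[set s : tuples | B (tuple_circulant R s)]%SET|)%N.
Proof.
set bad := [set S | _]%SET.
have badP S : S \in bad -> #|S| = d /\ B (set_circulant S).
  by rewrite inE => /andP[/eqP].
move: bad badP => bad badP.
apply: (@leq_trans #|[set s : tuples | injectiveb s && ([set s j | j : 'I_d]%SET \in bad)]%SET|).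
  rewrite -[X in (_ <= X)%N]sum1_card (partition_big (fun s : tuples => [set s j | j : 'I_d]%SET) (mem bad)) /=; last first.
    by move=> s; rewrite inE => /andP[].
  rewrite -sum_nat_const; apply: leq_sum => S Sbad.
  have [Sd _] := badP _ Sbad.
  rewrite -(card_tuples_with_image Sd) -sum1_card; apply: eq_leq.
  apply: eq_bigl => s; rewrite !inE.
  by case: (injectiveb s) => //=; case: eqP => [->|]; rewrite ?andbF ?Sbad ?andbT.
apply/subset_leq_card/fintype.subsetP => s; rewrite !inE => /andP[/injectiveP sinj /badP[_ Bs]].
by rewrite tuple_circulant_inj_image.
Qed.

Lemma ffact_ge_half n : (2 * d <= n)%N -> (n ^ d <= 2 ^ d * n ^_ d)%N.
Proof.
move=> dn; rewrite ffact_prod -{1 2}(card_ord d) -!prod_nat_const -big_split /=.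
by apply: leq_prod => i _; have := ltn_ord i; lia.
Qed.

Section uniform_circulant.
Variables (dd : measure_display) (Omega : measurableType dd).
Variables (P : probability Omega R) (C : Omega -> 'M[R[i]]_#|G|).
Variable (B : pred 'M[R[i]]_#|G|).
Hypothesis C_uniform : uniform_on P C (circulant01 R G d).

Let bad := [set S : {set G} | (#|S| == d) && B (set_circulant S)]%SET.

Let event_bigsetU : [set w | B (C w)] =
  \big[setU/set0]_(A <- [fset set_circulant S | S in bad]%fset) (C @^-1` [set A]).
Proof.
have [_ CS _] := C_uniform; rewrite circulant01_image in CS.
rewrite -bigcup_fset; apply/seteqP; split=> [w /= Bw|w [A /= /imfsetP[S /=]]].
  exists (C w) => //=; have := CS w => /imfsetP[S /=]; rewrite inE => Sd CE.
  by apply/imfsetP; exists S => //=; rewrite inE Sd -CE.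
by rewrite inE => /andP[_ BS] -> ->.
Qed.

Let bad01 A : A \in [fset set_circulant S | S in bad]%fset -> circulant01 R G d A.
Proof.
by move=> /imfsetP[S /=]; rewrite inE => /andP[/eqP Sd _] ->; exact: set_circulant01.
Qed.

Lemma uniform_circulant_measurable : measurable [set w | B (C w)].
Proof.
have [_ _ CP] := C_uniform; rewrite event_bigsetU big_seq.
by apply: bigsetU_measurable => A /bad01 /CP[].
Qed.

(** Conditioning a uniform tuple to be injective multiplies probabilities by at
    most [n^d / n^_d], which is at most [2^d] for [n >= 2 * d]. *)
Lemma uniform_circulant_probability : (2 * d <= #|G|)%N ->
  (P [set w | B (C w)] <=
    (2 ^+ d * mean (fun s : tuples => (B (tuple_circulant R s))%:R))%:E)%E.
Proof.
move=> dG; have [_ _ CP] := C_uniform.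
have card01 : #|` fset_set (circulant01 R G d)| = 'C(#|G|, d).
  by rewrite circulant01_image set_fsetK card_set_circulant card_draws.
rewrite card01 in CP; rewrite event_bigsetU.
rewrite measure_fbigsetU; last 2 first.
- by move=> A /bad01 /CP[].
- by apply: trivIset_preimage1.
rewrite big_seq (eq_bigr (fun=> ('C(#|G|, d)%:R^-1)%:E)); last first.
  by move=> A /bad01 /CP[].
rewrite -big_seq sumEFin lee_fin big_const_seq count_predT iter_addr addr0.
rewrite -[size _]/(#|` _|) card_set_circulant.
rewrite mean_pred card_ffun card_ord -[_ *+ #|bad|]mulr_natl.
have h1 := bad_sets_le_bad_tuples B; rewrite -/bad in h1.
set T := #|[set s | _]%SET| in h1 *.
have h2 := ffact_ge_half dG.
have dN : (d <= #|G|)%N by apply: leq_trans dG; rewrite leq_pmull.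
have C0 : 0 < 'C(#|G|, d)%:R :> R by rewrite ltr0n bin_gt0.
have N0 : 0 < (#|G| ^ d)%N%:R :> R by rewrite ltr0n expn_gt0 card_finZmod_gt0.
have f0 : 0 < d`!%:R :> R by rewrite ltr0n fact_gt0.
have F0 : 0 < (#|G| ^_ d)%:R :> R by rewrite ltr0n ffact_gt0.
have -> : #|bad|%:R / 'C(#|G|, d)%:R = (#|bad| * d`!)%N%:R / (#|G| ^_ d)%:R :> R.
  by rewrite -bin_ffact !natrM; field; rewrite !gt_eqF.
apply: le_trans (_ : _ <= T%:R / (#|G| ^_ d)%:R) _.
  by rewrite ler_pM2r ?invr_gt0// ler_nat.
rewrite mulrA ler_pdivrMr// mulrAC ler_pdivlMr//.
rewrite [2 ^+ d * _]mulrC -mulrA ler_wpM2l//.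
by rewrite -natrX -natrM ler_nat.
Qed.

End uniform_circulant.

End sets_and_tuples.

(** * Asymptotics of the mean logarithm *)

(** For finite [m] the sums are bounded away from 0 by integrality, and
    [log_poly_cvg_uniform] applies. For [m = oo] a matching character has large
    order, and [tail_bound] applies. A mismatched character has bounded order,
    and its contribution is only bounded crudely because there are few of them. *)
Lemma tail_uniform (R : realType) (m : posN_infty) (d : nat) (delta : R) :
  (0 < d)%N -> 0 < delta ->
  exists J r : nat, exists B : R, [/\ (size (log_poly d J : {poly R}) <= r)%N, 0 <= B &
  forall (G : finZmodType) (chi : G -> R[i]), is_char chi ->
    ~ sumset d (roots_of_unity R (exponent [set: G]%SET)) 0 ->
    (forall e, (e <= r)%N -> order_dvd m e -> forall x : G, x *+ e = 0) ->
    (matches_order m r chi -> mean (fun s : {ffun 'I_d -> G} =>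
       (log_poly d J).[cabs (csum chi s) ^+ 2] - ln (cabs (csum chi s))) <= delta) /\
    (~~ matches_order m r chi ->
       forall s : {ffun 'I_d -> G}, - B <= ln (cabs (csum chi s)))].
Proof.
move=> d0 del0; have d0' : 0 < d%:R :> R by rewrite ltr0n.
set D : R := ln d%:R; have D0 : 0 <= D by apply: ln_ge0; rewrite ler1n.
have restrict (G : finZmodType) k : (k %| exponent [set: G]%SET)%N ->
    ~ sumset d (roots_of_unity R (exponent [set: G]%SET)) 0 ->
    ~ sumset d (roots_of_unity R k) 0.
  move=> /dvdnP[q ->] h [w wk E]; apply: h; exists w => // j.
  by rewrite /roots_of_unity /= mulnC exprM (wk j) expr1n.
have lnB (G : finZmodType) (chi : G -> R[i]) k r :
    is_char chi -> (0 < k)%N -> (forall e, trivial_pow chi e = (k %| e)%N) ->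
    ~ sumset d (roots_of_unity R k) 0 -> (k <= r)%N ->
    forall s : {ffun 'I_d -> G}, - (r%:R * D) <= ln (cabs (csum chi s)).
  move=> chic k0 chio h0 kr s; have := ln_cabs_csum_ge chio k0 d0 h0 s; rewrite -/D.
  have : k.-1%:R * D <= r%:R * D.
    by rewrite ler_wpM2r// ler_nat (leq_trans (leq_pred _)).
  lra.
case: m => [q|].
- have q0 : (0 < posN_val q)%N by exact: valP.
  pose x0 : R := expR (- ((posN_val q)%:R * D)).
  have x00 : 0 < x0 by exact: expR_gt0.
  have x01 : x0 <= 1 by rewrite -expR0 ler_expR oppr_le0 mulr_ge0.
  have [J hJ] := log_poly_cvg_uniform d0 (introT andP (conj x00 x01)) del0.
  exists J, (maxn (size (log_poly d J : {poly R})) (posN_val q)), ((posN_val q)%:R * D).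
  split=> [||G chi chic h0 tors]; [exact: leq_maxl|exact: mulr_ge0|].
  have [k [k0 kexp chio]] := char_order_exists chic.
  have hk := restrict _ _ kexp h0.
  have kq : (k <= posN_val q)%N.
    apply: dvdn_leq => //; rewrite -chio; apply/forallP => x; apply/eqP.
    by rewrite -charX// tors ?leq_maxr//= ?chic.1.
  have low := lnB _ _ _ _ chic k0 chio hk kq.
  split=> [_|_ s]; last exact: low.
  rewrite -[leRHS](@mean_cst R {ffun 'I_d -> G}) ?card_finZmod_gt0//.
  apply: ler_mean => s; have xpos := cabs_csum_gt0 chio hk s.
  have xd := cabs_csum_le chic s.
  have x0x : x0 <= cabs (csum chi s) by rewrite -[leRHS]lnK// ler_expR low.
  exact: (hJ J (leqnn J) _ (introT andP (conj x0x xd))).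
- have [J [K tailJ]] := tail_bound d0 del0.
  exists J, (maxn (size (log_poly d J : {poly R})) K),
    ((maxn (size (log_poly d J : {poly R})) K)%:R * D).
  set r := maxn _ _.
  split=> [||G chi chic h0 tors]; [exact: leq_maxl|exact: mulr_ge0|].
  have [k [k0 kexp chio]] := char_order_exists chic.
  have hk := restrict _ _ kexp h0.
  split=> [/forallP good|].
    apply: (tailJ J (leqnn _) _ _ k) => //; rewrite leqNgt; apply/negP => kK.
    have kr : (k < r.+1)%N by rewrite ltnS; apply: leq_trans (ltnW kK) (leq_maxr _ _).
    have /eqP := good (Ordinal kr); rewrite /= chio dvdnn => /esym/eqP k00.
    by rewrite k00 in k0.
  rewrite negb_forall => /existsP[e /= he]; apply: (lnB _ _ k) => //.
  move: he; rewrite chio /=; case: (posnP e) => [->|e0 he].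
    by rewrite dvdn0.
  apply: leq_trans (_ : e <= r)%N; last by rewrite -ltnS.
  apply: dvdn_leq => //; move: he; rewrite ?eqn0Ngt ?e0 /=.
  by case: (k %| e)%N.
Qed.

Section asymptotics.
Variables (R : realType) (d : nat) (G : nat -> finZmodType) (m : posN_infty).
Hypothesis d0 : (0 < d)%N.
Hypothesis nonvanishing : forall n, (1 <= n)%N ->
  ~ sumset d (roots_of_unity R (exponent [set: G n]%SET)) 0.
Hypothesis orders_cvg : weak_cvg (fun n => rho R (G n)) (\d_(m : borel posN_infty)).
Variable lam : forall n, 'I_#|G n| -> G n -> R[i].
Hypothesis lam_char : forall n i, is_char (lam (n := n) i).
Hypothesis lam_trace : forall n x, \sum_i lam (n := n) i x = #|G n|%:R *+ (x == 0).
Hypothesis lam_det : forall n (a : G n -> R[i]),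
  \det (circulant a) = \prod_i \sum_x a x * lam (n := n) i x.

Definition torsion_ok r n := forall e, (e <= r)%N -> order_dvd m e ->
  forall x : G n, x *+ e = 0.

Lemma torsion_ok_near r : \forall n \near \oo, torsion_ok r n.
Proof.
have : \forall n \near \oo, forall e : 'I_r.+1, order_dvd m e -> forall x : G n, x *+ e = 0.
  apply: filter_forall => e; case: (boolP (order_dvd m e)) => [oe|_]; last exact: nearW.
  by have [n0 h] := weak_cvg_torsion_dvd orders_cvg oe; exists n0 => // n nn0 _; exact: h.
apply: filterS => n h e er; exact: (h (Ordinal (er : (e < r.+1)%N))).
Qed.

Lemma mismatch_near r (eps : R) : 0 < eps ->
  \forall n \near \oo, mismatch m (@lam n) r <= eps.
Proof.
move=> eps0; pose eps' := eps / r.+1%:R.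
have eps'0 : 0 < eps' by rewrite divr_gt0.
have small : \forall n \near \oo, forall e : 'I_r.+1, ~~ order_dvd m e ->
    #|[set x : G n | x *+ e == 0]%SET|%:R / #|G n|%:R <= eps'.
  apply: filter_forall => e; case: (boolP (~~ order_dvd m e)) => [oe|_]; last exact: nearW.
  by have [n0 h] := weak_cvg_torsion_ndvd orders_cvg oe eps'0; exists n0 => // n nn0 _; exact: h.
near=> n; apply: le_trans (mismatch_le (lam_char (n := n)) (lam_trace (n := n)) _) _.
  by near: n; exact: torsion_ok_near.
have hs : forall e : 'I_r.+1, ~~ order_dvd m e ->
    #|[set x : G n | x *+ e == 0]%SET|%:R / #|G n|%:R <= eps' by near: n.
apply: le_trans (_ : _ <= \sum_(e < r.+1) eps') _.
  rewrite big_mkcond; apply: ler_sum => e _; case: ifP => [|_]; last exact: ltW.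
  exact: hs.
by rewrite sumr_const card_ord -mulr_natl mulrC mulfVK// pnatr_eq0.
Unshelve. all: by end_near. Qed.

Lemma matching_char_near r : \forall n \near \oo, exists i, matches_order m r (@lam n i).
Proof.
have := mismatch_near r (_ : 0 < 2^-1 :> R); rewrite invr_gt0 => /(_ (ltr0n _ 2)).
apply: filterS => n; apply: contraTP => /forallNP h; rewrite -ltNge.
rewrite /mismatch (eq_mean (g := fun=> 1)) ?mean_cst ?card_ord ?card_finZmod_gt0//.
  lra.
by move=> i; have /negP/negbTE -> := h i.
Qed.

(** The moments of the limit law are averages over tuples of some [G n]. *)
Lemma asymptotic_moment_fin r :
  (\int[conv_pow (eta R m) d]_z (cabs (z : R[i]) ^+ r.*2)%:E = (abs_moment R m d r)%:E)%E.
Proof.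
have [n [i good]] : exists n, exists i, matches_order m r (@lam n i).
  by have [n0 _ h] := matching_char_near r; exists n0; exact: (h n0 (leqnn _)).
by rewrite /abs_moment !(abs_moment_char d (lam_char i) good).
Qed.

Definition log_det n (s : {ffun 'I_d -> G n}) : R :=
  (#|G n|%:R)^-1 * ln (cabs (\det (tuple_circulant R s))).

Section one_group.
Variable n : nat.
Hypothesis n1 : (1 <= n)%N.
Implicit Types s : {ffun 'I_d -> G n}.

Let csum_gt0 i s : 0 < cabs (csum (@lam n i) s).
Proof.
rewrite lt_neqAle cabs_ge0 andbT eq_sym cabs_eq0; apply/eqP => E.
apply: (nonvanishing n1); exists (fun j => lam i (s j)) => // j.
have xG : s j \in [set: G n]%G by rewrite inE.
rewrite /roots_of_unity /= -charX//.
by rewrite -(lam_char i).1; congr lam; exact: (expg_exponent xG).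
Qed.

Lemma det_tuple_circulant s :
  \det (tuple_circulant R s) = \prod_i csum (@lam n i) s.
Proof. by rewrite lam_det; apply: eq_bigr => i _; rewrite tuple_circulant_eigen. Qed.

Lemma cabs_det_gt0 s : 0 < cabs (\det (tuple_circulant R s)).
Proof. by rewrite det_tuple_circulant cabs_prod prodr_gt0. Qed.

Lemma log_det_mean s : log_det s = mean (fun i => ln (cabs (csum (@lam n i) s))).
Proof.
rewrite /log_det /mean card_ord; congr (_ * _).
rewrite det_tuple_circulant cabs_prod.
have lnprod (I : Type) (q : seq I) (F : I -> R) : (forall i, 0 < F i) ->
    ln (\prod_(i <- q) F i) = \sum_(i <- q) ln (F i).
  move=> F0; elim: q => [|i q IH]; first by rewrite !big_nil ln1.
  by rewrite !big_cons lnM ?posrE ?IH ?prodr_gt0.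
by rewrite lnprod.
Qed.

Lemma log_det_ge0 s : 0 <= log_det s.
Proof.
rewrite mulr_ge0 ?invr_ge0// ln_ge0// cabs_det_tuple_circulant_ge1//.
by rewrite -cabs_eq0 gt_eqF// cabs_det_gt0.
Qed.

Lemma log_det_le_spectral_mean J s :
  log_det s <= spectral_mean (@lam n) (log_poly d J) s.
Proof.
rewrite log_det_mean; apply: ler_mean => i.
have xd := cabs_csum_le (lam_char i) s.
by have /andP[+ _] := log_poly_bounds J d0 (introT andP (conj (csum_gt0 i s) xd)); lra.
Qed.

End one_group.

Local Notation P J := (poly_mean m d (log_poly d J : {poly R})).

Lemma spectral_mean_near J (eps : R) : 0 < eps -> \forall n \near \oo,
  mean (fun s : {ffun 'I_d -> G n} => `|spectral_mean (@lam n) (log_poly d J) s - P J|) <= eps.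
Proof.
move=> eps0; pose p : {poly R} := log_poly d J.
pose K : R := \sum_(r < size p) `|p`_r| * d%:R ^+ r.*2.
have K0 : 0 <= K by apply: sumr_ge0 => r _; rewrite mulr_ge0 ?exprn_ge0.
have eps'0 : 0 < eps / (K + 1) by rewrite divr_gt0// ltr_wpDl.
near=> n.
have [i good] : exists i, matches_order m (size p) (@lam n i).
  by near: n; exact: matching_char_near.
have tors : torsion_ok (size p) n by near: n; exact: torsion_ok_near.
apply: le_trans (spectral_mean_deviation d (lam_char (n := n)) (lam_trace (n := n))
  (lam_char i) good tors) _.
rewrite -/K; have mis : mismatch m (@lam n) (size p) <= eps / (K + 1).
  by near: n; exact: mismatch_near.
apply: le_trans (ler_wpM2l K0 mis) _.
by rewrite mulrCA ler_piMr ?(ltW eps0)// ler_pdivrMr ?ltr_wpDl// mul1r lerDl.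
Unshelve. all: by end_near. Qed.

(** The logarithm of the determinant is nonnegative by integrality and lies
    below [spectral_mean], which concentrates at [poly_mean]. *)
Lemma poly_mean_ge0 J : 0 <= P J.
Proof.
apply/ler_addgt0Pr => eps eps0; rewrite addrC -lerBlDl sub0r.
have [n [n1 h]] : exists n, (1 <= n)%N /\
    mean (fun s : {ffun 'I_d -> G n} => `|spectral_mean (@lam n) (log_poly d J) s - P J|) <= eps.
  have [n0 _ h] := spectral_mean_near J eps0.
  by exists n0.+1; split=> //; exact: (h n0.+1 (leqnSn _)).
rewrite lerNl; apply: le_trans h; rewrite -[leLHS](@mean_cst R {ffun 'I_d -> G n}) ?card_finZmod_gt0//.
apply: ler_mean => s; apply: le_trans (ler_norm _).
by rewrite lerBDr addNr (le_trans (log_det_ge0 n1 s))// log_det_le_spectral_mean.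
Qed.

Lemma c_const_finite : exists c : R, [/\ c_const R m d = c%:E, 0 <= c,
  forall J, c <= P J & forall eps, 0 < eps -> exists J, P J <= c + eps].
Proof.
have [c [cE cP Pc]] := c_const_limit d0 asymptotic_moment_fin poly_mean_ge0.
exists c; split=> //.
  have <- : limn (fun J => P J) = c by apply/cvg_lim.
  by apply: limr_ge; [apply: cvgP Pc|apply: nearW; exact: poly_mean_ge0].
move=> eps eps0; have /cvgrPdist_le /(_ _ eps0) [J _ hJ] := Pc; exists J.
by have := hJ J (leqnn _); rewrite /= ler_distlC => /andP[]; lra.
Qed.

(** After exchanging the averages, a matching character contributes [poly_mean],
    which is at least [c], up to the tail. *)
Lemma mean_log_det_near (c eps : R) : 0 <= c -> (forall J, c <= P J) -> 0 < eps ->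
  \forall n \near \oo, c - eps <= mean (@log_det n).
Proof.
move=> c0 cP eps0; have eps2 : 0 < eps / 2 by rewrite divr_gt0.
have [J [r [B [Jr B0 tail]]]] := tail_uniform m d0 eps2.
have mis0 : 0 < eps / 2 / (B + c + 1) by rewrite divr_gt0// ltr_wpDl// addr_ge0.
near=> n; have n1 : (1 <= n)%N by near: n; exact: nbhs_infty_ge.
have tors : torsion_ok r n by near: n; exact: torsion_ok_near.
have mis : mismatch m (@lam n) r <= eps / 2 / (B + c + 1).
  by near: n; exact: mismatch_near.
rewrite (eq_mean (log_det_mean n1)) mean_exchange.
pose f i := - mean (fun s : {ffun 'I_d -> G n} => ln (cabs (csum (lam i) s))).
suff h : mean f <= (eps / 2 - c) + (B + eps / 2 - (eps / 2 - c)) * mismatch m (@lam n) r.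
  have : (B + c) * mismatch m (@lam n) r <= eps / 2.
    apply: le_trans (ler_wpM2l (addr_ge0 B0 c0) mis) _.
    have Bc : 0 < B + c + 1 by rewrite ltr_wpDl// addr_ge0.
    by rewrite mulrCA ler_piMr ?(ltW eps2)// ler_pdivrMr// mul1r lerDl.
  by move: h; rewrite meanN; lra.
have good i : matches_order m r (lam i) -> f i <= eps / 2 - c.
  move=> gi; have [/(_ gi) ti _] := tail _ _ (lam_char i) (nonvanishing n1) tors.
  move: ti; rewrite meanB (poly_mean_char d (lam_char i) (matches_order_le Jr gi)).
  by have := cP J; rewrite /f; lra.
apply: (ler_mean_mismatch _ _ good); first by lra.
move=> i; have [gi|bi] := boolP (matches_order m r (lam i)).
  by apply: le_trans (good i gi) _; lra.
have [_ /(_ bi) ti] := tail _ _ (lam_char i) (nonvanishing n1) tors.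
rewrite /f lerNl; apply: le_trans (_ : - B <= _); first by lra.
rewrite -[leLHS](@mean_cst R {ffun 'I_d -> G n}) ?card_finZmod_gt0//.
exact: ler_mean.
Unshelve. all: by end_near. Qed.

(** The upper bound is [log_det_le_spectral_mean] with concentration, the lower
    bound holds for the mean; [mean_abs_deviation] combines them. *)
Lemma log_det_L1_near (c eps : R) : 0 <= c -> (forall J, c <= P J) ->
  (forall eps, 0 < eps -> exists J, P J <= c + eps) -> 0 < eps ->
  \forall n \near \oo, mean (fun s => `|@log_det n s - c|) <= eps.
Proof.
(* [mean_abs_deviation] counts the two errors of the upper bound twice and the
   error of the lower bound once, whence [eps / 5]. *)
move=> c0 cP Pc eps0; have eps5 : 0 < eps / 5 by rewrite divr_gt0.
have [J hJ] := Pc _ eps5.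
near=> n; have n1 : (1 <= n)%N by near: n; exact: nbhs_infty_ge.
have low : c - eps / 5 <= mean (@log_det n) by near: n; exact: mean_log_det_near.
have up : mean (fun s : {ffun 'I_d -> G n} => `|spectral_mean (@lam n) (log_poly d J) s - P J|) <= eps / 5.
  by near: n; exact: spectral_mean_near.
rewrite mean_abs_deviation ?card_finZmod_gt0//.
suff : mean (fun s => Num.max (@log_det n s - c) 0) <= eps / 5 + eps / 5 by lra.
apply: le_trans (_ : _ <= mean (fun s : {ffun 'I_d -> G n} =>
  `|spectral_mean (@lam n) (log_poly d J) s - P J| + eps / 5)) _; last first.
  by rewrite meanD mean_cst ?card_finZmod_gt0// lerD2r.
apply: ler_mean => s; rewrite ge_max addr_ge0 ?(ltW eps5)// andbT.
have h1 := log_det_le_spectral_mean n1 J s.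
have h2 := ler_norm (spectral_mean (@lam n) (log_poly d J) s - P J).
lra.
Unshelve. all: by end_near. Qed.

End asymptotics.

(** * Convergence in probability *)

Theorem theorem1p6 (R : realType) (d : nat) (G : nat -> finZmodType)
  (m : posN_infty)
  (disp : nat -> measure_display) (Omega : forall n, measurableType (disp n))
  (P : forall n, probability (Omega n) R)
  (C : forall n, Omega n -> 'M[R[i]]_#|G n|) :
  (0 < d)%N ->
  #|G n| @[n --> \oo] --> \oo ->
  (forall n, (1 <= n)%N -> (d <= #|G n|)%N ->
    uniform_on (P n) (C n) (circulant01 R (G n) d)) ->
  (forall n, (1 <= n)%N ->
    ~ sumset d (roots_of_unity R (exponent [set: G n]%SET)) 0) ->
  weak_cvg (fun n => rho R (G n)) (\d_(m : borel posN_infty)) ->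
  [/\ c_const R m d \is a fin_num,
      (0 <= c_const R m d)%E,
      cvg_in_probability P
        (fun n w => ((#|G n|%:R)^-1)%:E * lne (cabs (\det (C n w)))%:E)%E
        (c_const R m d) &
      forall eps delta : R, 0 < eps -> 0 < delta ->
        exists2 n0 : nat, (1 <= n0)%N & forall n, (n0 <= n)%N ->
          ((1 - delta)%:E <=
           P n [set w | (expR ((fine (c_const R m d) - eps) * #|G n|%:R)
                          <= cabs (\det (C n w)))%R /\
                        (cabs (\det (C n w))
                          <= expR ((fine (c_const R m d) + eps) * #|G n|%:R))%R])%E].
Proof.
move=> d0 Ginf Cunif nonvanishing orders_cvg.
have [lam lamP] : {lam : forall n, 'I_#|G n| -> G n -> R[i] |
    forall n, [/\ forall i, is_char (lam n i),
      forall x, \sum_i lam n i x = #|G n|%:R *+ (x == 0) &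
      forall a, \det (circulant a) = \prod_i \sum_x a x * lam n i x]}.
  exists (fun n => projT1 (cid (circulant_diagonalization R (G n)))) => n.
  by case: cid.
have lam_char n i : is_char (lam n i) by have [] := lamP n.
have lam_trace n x : \sum_i lam n i x = #|G n|%:R *+ (x == 0) by have [] := lamP n.
have lam_det n a : \det (circulant a) = \prod_i \sum_x a x * lam n i x.
  by have [] := lamP n.
have [c [cE c0 cP Pc]] := c_const_finite d0 nonvanishing orders_cvg lam_char lam_trace lam_det.
have G_large : \forall n \near \oo, (2 * d <= #|G n|)%N.
  exact: (Ginf _ (nbhs_infty_ge (2 * d))).
have deviation (eps eta : R) : 0 < eps -> 0 < eta -> \forall n \near \oo,
    [/\ (1 <= n)%N, (2 * d <= #|G n|)%N &
    2 ^+ d * mean (fun s : {ffun 'I_d -> G n} => (eps < `|log_det R s - c|)%R%:R) <= eta].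
  move=> eps0 eta0; have q0 : 0 < eps * eta / 2 ^+ d.
    by rewrite divr_gt0 ?mulr_gt0 ?exprn_gt0.
  near=> n; split; [by near: n; exact: nbhs_infty_ge|by near: n|].
  have L1 : mean (fun s : {ffun 'I_d -> G n} => `|log_det R s - c|) <= eps * eta / 2 ^+ d.
    near: n; exact: (log_det_L1_near d0 nonvanishing orders_cvg lam_char lam_trace lam_det).
  have markov : eps * mean (fun s : {ffun 'I_d -> G n} => (eps < `|log_det R s - c|)%R%:R)
      <= mean (fun s : {ffun 'I_d -> G n} => `|log_det R s - c|).
    rewrite -meanZ; apply: ler_mean => s; case: ltP => h; last by rewrite mulr0.
    by rewrite mulr1 ltW.
  rewrite mulrC -ler_pdivlMr ?exprn_gt0//.
  by rewrite -(ler_pM2l eps0) [leRHS]mulrA; exact: le_trans markov L1.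
have gt0_det n s : (1 <= n)%N -> 0 < cabs (\det (@tuple_circulant R (G n) d s)).
  by move=> n1; exact: (cabs_det_gt0 nonvanishing lam_char lam_det n1).
split; first by rewrite cE.
- by rewrite cE lee_fin.
- move=> e e0; rewrite cE.
  have key (eta : R) : 0 < eta -> \forall n \near \oo, (0 <= P n [set w |
      (e%:E < `|((#|G n|%:R)^-1)%:E * lne (cabs (\det (C n w)))%:E - c%:E|)%E] <= eta%:E)%E.
    move=> eta0; apply: filterS (deviation _ _ e0 eta0) => n [n1 Gd dev].
    rewrite measure_ge0 /=.
    have dG : (d <= #|G n|)%N by apply: leq_trans Gd; rewrite leq_pmull.
    apply: le_trans (uniform_circulant_probability (fun A =>
      (e%:E < `|((#|G n|%:R)^-1)%:E * lne (cabs (\det A))%:E - c%:E|)%E) (Cunif n n1 dG) Gd) _.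
    rewrite lee_fin; apply: le_trans dev; rewrite ler_pM2l ?exprn_gt0//.
    apply: ler_mean => s; rewrite lne_EFin; last exact: gt0_det.
    by rewrite -EFinM -EFinB abse_EFin lte_fin.
  apply/fine_cvgP; split.
    apply: filterS (key _ ltr01) => n /andP[h0 h1].
    by rewrite ge0_fin_numE// (le_lt_trans h1)// ltry.
  apply/cvgrPdist_le => eta eta0; apply: filterS (key _ eta0) => n /andP[h0 h1].
  rewrite /= sub0r normrN ger0_norm ?fine_ge0// -lee_fin fineK//.
  by rewrite ge0_fin_numE// (le_lt_trans h1)// ltry.
- move=> eps delta eps0 delta0; rewrite cE /=.
  have [n0 _ h] := deviation _ _ eps0 delta0.
  exists n0.+1 => // n nn0; have [n1 Gd dev] := h n (ltnW nn0).
  have dG : (d <= #|G n|)%N by apply: leq_trans Gd; rewrite leq_pmull.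
  have CU := Cunif n n1 dG.
  pose N : R := #|G n|%:R; have N0 : 0 < N by rewrite ltr0n card_finZmod_gt0.
  pose good (A : 'M[R[i]]_#|G n|) := (expR ((c - eps) * N) <= cabs (\det A))
    && (cabs (\det A) <= expR ((c + eps) * N)).
  have -> : [set w | expR ((c - eps) * N) <= cabs (\det (C n w)) /\
      cabs (\det (C n w)) <= expR ((c + eps) * N)] = ~` [set w | ~~ good (C n w)].
    apply/seteqP; split=> w /=; rewrite /good; first by move=> [-> ->].
    by move=> /negP; rewrite negbK => /andP[].
  rewrite probability_setC; last exact: (uniform_circulant_measurable (fun A => ~~ good A) CU).
  rewrite EFinB leeB//; apply: le_trans (uniform_circulant_probability (fun A => ~~ good A) CU Gd) _.
  rewrite lee_fin; apply: le_trans dev; rewrite ler_pM2l ?exprn_gt0//.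
  apply: ler_mean => s; rewrite ler_nat; have x0 := gt0_det n s n1.
  case: (ltP eps) => [|hs]; first by rewrite leq_b1.
  rewrite leqn0 eqb0 negbK /good; set x := cabs _ in x0 *.
  have -> : x = expR (log_det R s * N).
    by rewrite /log_det mulrAC mulVf ?gt_eqF// mul1r lnK.
  by move: hs; rewrite !ler_expR !ler_pM2r// ler_norml => /andP[]; lra.
Unshelve. all: by end_near. Qed.
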